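(* Let $\mathbb{F}$ be a field, $1\le h\le n$, and let $\mu=(0^{n-h},1^{h-1},n-h+1)$ be a hook, viewed as the composition $(1^{h-1},n-h+1)$ of $n$ (so $D(\mu)=\{1,\dots,h-1\}$). Then the $H_n(0)$-module $R_\mu=\mathbb{F}[\mathbf{x}]/I_\mu$ satisfies \[ R_\mu\cong\bigoplus_{\alpha\preccurlyeq\mu}\mathbf P_\alpha . \]
   Context: $\mathbb{F}[\mathbf{x}]=\mathbb{F}[x_1,\dots,x_n]$. $H_n(0)$ is generated by $T_1,\dots,T_{n-1}$ with $T_i^2=-T_i$, $T_iT_{i+1}T_i=T_{i+1}T_iT_{i+1}$, $T_iT_j=T_jT_i$ ($|i-j|>1$); $T'_i=T_i+1$; $T_w,T'_w$ via reduced words. It acts on $\mathbb{F}[\mathbf{x}]$ by $T_i\mapsto\pi_i-1$ where $\pi_if=\frac{x_if-x_{i+1}s_i(f)}{x_i-x_{i+1}}$; this action preserves $I_\mu$ when $\mu$ is a hook, hence acts on $R_\mu$. Tanisaki ideal: writing $\mu$ and its conjugate increasingly with $n$ parts, $\mu'=(0\le\mu'_1\le\dots\le\mu'_n)$, $d_k(\mu)=\mu'_1+\dots+\mu'_k$, $I_\mu$ is generated by all $e_r(S)$ with $S\subseteq\{x_1,\dots,x_n\}$, $|S|=k$, $k\ge r>k-d_k(\mu)$ ($e_r(S)$ the elementary symmetric polynomial). For compositions $\alpha,\beta$ of $n$, $D(\alpha)$ is the set of partial sums $\alpha_1,\alpha_1+\alpha_2,\dots$ below $n$, and $\alpha\preccurlyeq\beta$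 iff $D(\alpha)\subseteq D(\beta)$; $\alpha^c$ has $D(\alpha^c)=[n-1]\setminus D(\alpha)$. $w_0(\alpha)$ is the longest element of the subgroup of $\mathfrak S_n$ generated by $\{s_i:i\in D(\alpha)\}$, and $\mathbf P_\alpha:=H_n(0)T_{w_0(\alpha)}T'_{w_0(\alpha^c)}$ is the projective indecomposable $H_n(0)$-module indexed by $\alpha$. *)

(* Defs.v *)
From HB Require Import structures.
From mathcomp Require Import all_boot all_order all_algebra all_fingroup.
From mathcomp Require Import mpoly.
From Stdlib Require Import ClassicalEpsilon.
Set Implicit Arguments. Unset Strict Implicit. Unset Printing Implicit Defensive.
Import Order.TTheory GRing.Theory.
Local Open Scope ring_scope.

(* Generators of H_n(0) / simple transpositions are indexed 0-based by
   i : 'I_n.-1 ; the paper's s_{i+1} = (i, i+1) (0-based positions), and the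
   paper's variable x_{k} is 'X_(k-1). *)

Lemma gen_hi_proof n (i : 'I_n.-1) : (i.+1 < n)%N.
Proof. case: i => i /=; case: n => //= n Hi. Qed.

Definition gen_lo n (i : 'I_n.-1) : 'I_n := widen_ord (leq_pred n) i.
Definition gen_hi n (i : 'I_n.-1) : 'I_n := Ordinal (gen_hi_proof i).

Definition sgen n (i : 'I_n.-1) : 'S_n := tperm (gen_lo i) (gen_hi i).

Definition plength n (w : 'S_n) : nat :=
  #|[set p : 'I_n * 'I_n | (p.1 < p.2)%N && (w p.2 < w p.1)%N]|.

(* ---------- The regular left H_n(0)-module ----------
   H_n(0) has basis {T_w : w in S_n}; an element is its coordinate function.
   Left multiplication by T_i:  T_i T_w = T_{s_i w} if l(s_i w) > l(w),
   and = - T_w otherwise. *)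
Definition Hreg (F : fieldType) n := {ffun 'S_n -> F}.

Definition Tact (F : fieldType) n (i : 'I_n.-1) (c : Hreg F n) : Hreg F n :=
  [ffun u => if (plength (sgen i * u)%g < plength u)%N
             then c (sgen i * u)%g - c u else 0].

Definition Hone (F : fieldType) n : Hreg F n := [ffun u => if u == 1%g then 1 else 0].

Definition applyT (F : fieldType) n (s : seq 'I_n.-1) (c : Hreg F n) : Hreg F n :=
  foldr (@Tact F n) c s.
Definition Tpact (F : fieldType) n (i : 'I_n.-1) (c : Hreg F n) : Hreg F n :=
  [ffun u => Tact i c u + c u].
Definition applyTp (F : fieldType) n (s : seq 'I_n.-1) (c : Hreg F n) : Hreg F n :=
  foldr (@Tpact F n) c s.

(* Reduced word of the longest element w_0(J) of the parabolic subgroup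
   generated by {s_i : i in J}: for each maximal run {a,...,b} of J the word
   a (a+1 a) (a+2 a+1 a) ... (b ... a). *)
Fixpoint downrun (P : pred nat) (j : nat) : seq nat :=
  match j with
  | 0 => if P 0%N then [:: 0%N] else [::]
  | j'.+1 => if P j then j :: downrun P j' else [::]
  end.

Definition w0word n (J : {set 'I_n.-1}) : seq 'I_n.-1 :=
  let P := fun k : nat => [exists x in J, val x == k] in
  pmap insub (flatten [seq downrun P j | j <- iota 0 n.-1 & P j]).

Definition projgen (F : fieldType) n (J : {set 'I_n.-1}) : Hreg F n :=
  applyT (w0word J) (applyTp (w0word (~: J)) (Hone F n)).

(* P_alpha = H_n(0) T_{w0(alpha)} T'_{w0(alpha^c)}, a left ideal: the span of
   the T_{i1}...T_{ik} e  (the products of generators span H_n(0)). *)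
Definition inP (F : fieldType) n (J : {set 'I_n.-1}) (v : Hreg F n) : Prop :=
  exists s : seq (F * seq 'I_n.-1),
    v = \sum_(p <- s) [ffun u => p.1 * applyT p.2 (projgen F J) u].

(* D(alpha) = partial sums alpha_1, alpha_1+alpha_2, ... that are < n,
   stored 0-based as a set of generator indices (s_k <-> index k-1). *)
Definition Dset n (alpha : seq nat) : {set 'I_n.-1} :=
  [set i : 'I_n.-1 | i.+1 \in [seq sumn (take k alpha) | k <- iota 1 (size alpha)]].

Definition conjpart (mu : seq nat) (j : nat) : nat := count (fun m => j <= m)%N mu.
(* mu' written increasingly with n parts: mu'_k = conjpart mu (n+1-k);
   d_k(mu) = mu'_1 + ... + mu'_k *)
Definition dk (n : nat) (mu : seq nat) (k : nat) : nat :=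
  \sum_(1 <= k' < k.+1) conjpart mu (n.+1 - k').

Definition esub (F : fieldType) n (S : {set 'I_n}) (r : nat) : {mpoly F[n]} :=
  \sum_(A : {set 'I_n} | (A \subset S) && (#|A| == r)) \prod_(i in A) 'X_i.

Definition tanisaki_gen n (mu : seq nat) (S : {set 'I_n}) (r : nat) : bool :=
  (r <= #|S|)%N && (#|S| < r + dk n mu #|S|)%N.

Definition inI (F : fieldType) n (mu : seq nat) (p : {mpoly F[n]}) : Prop :=
  exists s : seq ({mpoly F[n]} * ({set 'I_n} * nat)),
    all (fun t => tanisaki_gen mu t.2.1 t.2.2) s /\
    p = \sum_(t <- s) t.1 * esub F t.2.1 t.2.2.

(* pi_i f = (x_i f - x_{i+1} s_i(f)) / (x_i - x_{i+1}) : the (unique) exact quotient *)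
Definition pi_op (F : fieldType) n (i : 'I_n.-1) (f : {mpoly F[n]}) : {mpoly F[n]} :=
  epsilon (inhabits 0) (fun g : {mpoly F[n]} =>
    ('X_(gen_lo i) - 'X_(gen_hi i)) * g =
    'X_(gen_lo i) * f - 'X_(gen_hi i) * msym (sgen i) f).

Definition hook_parts (n h : nat) : seq nat := (n - h + 1)%N :: nseq h.-1 1%N.
Definition hook_comp (n h : nat) : seq nat := rcons (nseq h.-1 1%N) (n - h + 1)%N.

(* Main.v *)
(** For [u] in S_n with right descent set D(u), put b_u = T_u x_{D(u)}, where x_J
    is the product over i in J of the monomials x_1 ... x_i.  Up to monomials
    whose exponents have a smaller sum of squares, b_u is the descent monomial
    of u.  Garsia's straightening of monomials, which trades x_1 ... x_i and its
    permutations for the elementary symmetric polynomial e_i, then shows that the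
    products of the b_u, D(u) in [h-1], with monomials in e_1, ..., e_{h-1} span
    F[x] together with the monomials in at least h variables.  This family is
    indexed by the monomials themselves, so in each bounded degree it has the
    right size and is a basis.  For a hook, I_mu is generated by e_1, ...,
    e_{h-1} and the squarefree monomials of degree h, so the b_u with D(u) in
    [h-1] form a basis of R_mu.

    On the other side P_J is spanned by the T_w T'_{w0(J^c)} with D(w) = J.
    Since s_i fixes x_J for i not in J, the module morphism 1 |-> x_J sends
    T_w T'_{w0(J^c)} to b_w; hence the sum of the P_J, J in [h-1], maps
    bijectively onto R_mu. *)

Require Import Defs.
From HB Require Import structures.
From mathcomp Require Import all_boot all_order all_algebra all_fingroup.
From mathcomp Require Import mpoly zify ring.
From Stdlib Require Import ClassicalEpsilon.
Set Implicit Arguments. Unset Strict Implicit. Unset Printing Implicit Defensive.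
Import GRing.Theory.
Local Open Scope ring_scope.

(** * Descents and reduced words in the symmetric group *)

(** The ideal is seen inside the basis of F[x] because multiplication by e_i, i < h, sends b_u times
    a monomial in the e's to another such product, and a monomial in at least h variables to a sum
    of such monomials. So I_mu is spanned by part of the basis, and the b_u without factors e_i are
    what is left.

    Straightening must terminate under two rewritings. Replacing a monomial by b_u lowers the sum of
    squares, but trading variables for e_i can produce a rearrangement of the same exponents; a
    linear term preferring large exponents on the left settles these ties.

    On the side of P_J only spanning is proved: its spanning family has independent images in R_mu,
    and this gives injectivity.

    Both actions are instances of additive operators satisfying the braid relations, which are
    checked on the idempotents T_i + 1 and pi_i and then transported. *)

Section Coxeter.
Variable n : nat.
Implicit Types (i j : 'I_n.-1) (p q x : 'I_n) (u v w : 'S_n).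

(** Products of permutations act from left to right, so [sgen i * u] exchanges the values at two
    adjacent positions: left descents are drops of [u], right descents drops of its inverse. *)
Definition desc i u := (u (gen_hi i) < u (gen_lo i))%N.
Definition rdesc u : {set 'I_n.-1} :=
  [set i | ((u^-1)%g (gen_hi i) < (u^-1)%g (gen_lo i))%N].

Lemma sgenK i : (sgen i * sgen i = 1)%g.
Proof. exact: tperm2. Qed.

Lemma sgenV i : ((sgen i)^-1 = sgen i)%g.
Proof. exact: tpermV. Qed.

Lemma sgen_lo i : sgen i (gen_lo i) = gen_hi i.
Proof. exact: tpermL. Qed.

Lemma sgen_hi i : sgen i (gen_hi i) = gen_lo i.
Proof. exact: tpermR. Qed.

Lemma sgenKp i p : sgen i (sgen i p) = p.
Proof. by rewrite -permM sgenK perm1. Qed.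

Lemma sgen_id i p : val p != i -> val p != i.+1 -> sgen i p = p.
Proof. by move=> h1 h2; rewrite /sgen tpermD // -val_eqE /= eq_sym. Qed.

Lemma sgenE i p : sgen i p = (if p == i :> nat then i.+1 else if p == i.+1 :> nat then i : nat else p) :> nat.
Proof.
case: eqVneq => [e|n1]; first by have -> : p = gen_lo i by [apply: val_inj]; rewrite sgen_lo.
case: eqVneq => [e|n2]; first by have -> : p = gen_hi i by [apply: val_inj]; rewrite sgen_hi.
by rewrite sgen_id.
Qed.

Lemma sgen_lt i p q : (p < q)%N -> ~~ ((p == i :> nat) && (q == i.+1 :> nat)) ->
  (sgen i p < sgen i q)%N.
Proof. by rewrite !sgenE => ? ?; do 4?[case: ifP => ?]; lia. Qed.

Lemma sgen_commute i j : (i.+1 < j)%N -> (sgen i * sgen j = sgen j * sgen i)%g.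
Proof.
move=> hij; apply/permP=> p; apply: val_inj; rewrite !permM /= !sgenE.
by do 4?[case: (nat_of_ord p =P _) => ?]; do 4?[case: ifP => ?]; lia.
Qed.

Lemma sgen_braid i j : j = i.+1 :> nat ->
  (sgen i * sgen j * sgen i = sgen j * sgen i * sgen j)%g.
Proof.
move=> hij; apply/permP=> p; apply: val_inj; rewrite !permM /= !sgenE hij.
have E1 : (i == i.+1 :> nat) = false by lia.
have E2 : (i == i.+2 :> nat) = false by lia.
have E3 : (i.+1 == i :> nat) = false by lia.
have E4 : (i.+1 == i.+2 :> nat) = false by lia.
have E5 : (i.+2 == i :> nat) = false by lia.
have E6 : (i.+2 == i.+1 :> nat) = false by lia.
have [e0|[e1|[e2|[n0 n1 n2]]]] : (p : nat) = i \/ (p : nat) = i.+1 \/ (p : nat) = i.+2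
  \/ [/\ (p == i :> nat) = false, (p == i.+1 :> nat) = false & (p == i.+2 :> nat) = false].
- have [|n0] := eqVneq (p : nat) i; first by left.
  have [|n1] := eqVneq (p : nat) i.+1; first by right; left.
  have [|n2] := eqVneq (p : nat) i.+2; first by right; right; left.
  by do 3!right; split; apply: negbTE.
- by rewrite e0 !(eqxx, E1, E2, E3, E4, E5, E6).
- by rewrite e1 !(eqxx, E1, E2, E3, E4, E5, E6).
- by rewrite e2 !(eqxx, E1, E2, E3, E4, E5, E6).
- by rewrite !(n0, n1, n2).
Qed.

Lemma perm_lo_hi i u : u (gen_lo i) <> u (gen_hi i) :> nat.
Proof. by move/val_inj/perm_inj/(congr1 val) => /=; lia. Qed.

Lemma desc_sgenM i u : desc i (sgen i * u)%g = ~~ desc i u.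
Proof.
by rewrite /desc !permM sgen_lo sgen_hi; have := @perm_lo_hi i u; lia.
Qed.

Lemma desc_far_lo i j u : (i.+1 < j)%N -> desc i (sgen j * u)%g = desc i u.
Proof. by move=> hij; rewrite /desc !permM !(@sgen_id j) //=; lia. Qed.

Lemma desc_far_hi i j u : (i.+1 < j)%N -> desc j (sgen i * u)%g = desc j u.
Proof. by move=> hij; rewrite /desc !permM !(@sgen_id i) //=; lia. Qed.

Section Adjacent.
Variables i j : 'I_n.-1.
Hypothesis hij : j = i.+1 :> nat.

Let lo_hi : gen_lo j = gen_hi i. Proof. exact: val_inj. Qed.
Let sgen_i_hi : sgen i (gen_hi j) = gen_hi j. Proof. by apply: sgen_id => /=; lia. Qed.
Let sgen_j_lo : sgen j (gen_lo i) = gen_lo i. Proof. by apply: sgen_id => /=; lia. Qed.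

Lemma desc_adj_hi u : desc j (sgen i * u)%g = (u (gen_hi j) < u (gen_lo i))%N.
Proof. by rewrite /desc !permM sgen_i_hi lo_hi sgen_hi. Qed.

Lemma desc_adj_lo u : desc i (sgen j * u)%g = (u (gen_hi j) < u (gen_lo i))%N.
Proof. by rewrite /desc !permM sgen_j_lo -lo_hi sgen_lo. Qed.

Lemma desc_adj_lohi u : desc i (sgen j * (sgen i * u))%g = desc j u.
Proof. by rewrite desc_adj_lo !permM sgen_i_hi sgen_lo -lo_hi. Qed.

Lemma desc_adj_hilo u : desc j (sgen i * (sgen j * u))%g = desc i u.
Proof. by rewrite desc_adj_hi !permM sgen_j_lo sgen_hi lo_hi. Qed.

Lemma desc_adj_trans u : desc i u -> desc j u -> (u (gen_hi j) < u (gen_lo i))%N.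
Proof. by rewrite /desc lo_hi => h1 h2; apply: ltn_trans h2 h1. Qed.

End Adjacent.

(** Applying s_i to both entries of a pair embeds the inversions of [sgen i * u] into those of [u];
    the pair of exchanged positions is missed. *)
Lemma plength_desc i u : desc i u -> (plength (sgen i * u)%g < plength u)%N.
Proof.
move=> du; pose f (p : 'I_n * 'I_n) := (sgen i p.1, sgen i p.2).
have finj : injective f by move=> [a b] [c d] [/perm_inj-> /perm_inj->].
rewrite /plength; set A := finset _; set B := finset _.
rewrite -(card_imset A finj); apply: proper_card; apply/properP; split.
  apply/subsetP=> y /imsetP[[a b]]; rewrite inE /= !permM => /andP[ab sab] ->.
  rewrite inE /f /= sab andbT; apply: sgen_lt => //; apply/negP => /andP[/eqP ea /eqP eb].
  move: sab; have -> : a = gen_lo i by apply: val_inj.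
  have -> : b = gen_hi i by apply: val_inj.
  by rewrite sgen_lo sgen_hi; move: du; rewrite /desc; lia.
exists (gen_lo i, gen_hi i); first by rewrite inE /= leqnn.
apply/imsetP=> -[[a b]]; rewrite inE /= => /andP[ab _] [ea eb].
move: ab; rewrite -[a](sgenKp i) -[b](sgenKp i) -ea -eb sgen_lo sgen_hi /=; lia.
Qed.

Lemma plengthE i u : (plength (sgen i * u)%g < plength u)%N = desc i u.
Proof.
apply/idP/idP; last exact: plength_desc.
apply: contraTT => nd; rewrite -leqNgt ltnW //.
by rewrite -{1}[u]mul1g -(sgenK i) -mulgA plength_desc // desc_sgenM.
Qed.

Lemma rdesc_mulg i u : (i \in rdesc (u * sgen i)%g) = (i \notin rdesc u).
Proof.
rewrite !inE invMg sgenV !permM sgen_lo sgen_hi.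
by rewrite -leqNgt ltn_neqAle; case: eqP => // /(@perm_lo_hi i).
Qed.

Lemma rank_card u p : u p = #|[set q | (u q < u p)%N]| :> nat.
Proof.
rewrite -[RHS](card_imset _ (@perm_inj _ u)).
have -> : u @: [set q | (u q < u p)%N] = [set x : 'I_n | (x < u p)%N].
  apply/setP=> x; rewrite inE; apply/imsetP/idP => [[q]|h]; first by rewrite inE => ? ->.
  by exists ((u^-1)%g x); rewrite ?inE permKV.
by rewrite -sum1dep_card big_ord_narrow ?sum1_card ?card_ord // ltnW.
Qed.

Lemma perm_lt_inj u v : (forall p q, (u p < u q)%N = (v p < v q)%N) -> u = v.
Proof.
move=> h; apply/permP=> p; apply: val_inj; rewrite /= rank_card [RHS]rank_card.
by congr #|pred_of_set _|; apply/setP=> q; rewrite !inE h.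
Qed.

(** Without an adjacent drop [f] would increase weakly from [p] to [q]. Applied to the inverse of a
    permutation, this produces a right descent between two given ranks. *)
Lemma between_drop (f : 'I_n -> nat) p q : (p < q)%N -> (f q < f p)%N ->
  exists2 i : 'I_n.-1, (p <= i < q)%N & (f (gen_hi i) < f (gen_lo i))%N.
Proof.
move=> pq fpq.
case: (pickP (fun i : 'I_n.-1 => (p <= i < q)%N && (f (gen_hi i) < f (gen_lo i))%N)).
  by move=> i /andP[]; exists i.
move=> none; suff : (f p <= f q)%N by lia.
have H k : forall x, x = (p + k)%N :> nat -> (x <= q)%N -> (f p <= f x)%N.
  elim: k => [|k IH] x ex xq; first by rewrite (_ : x = p) //; apply: val_inj; rewrite /= ex addn0.
  have kn : (p + k < n.-1)%N by have := ltn_ord x; lia.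
  pose i := Ordinal kn; have := none i => /=.
  have -> : gen_hi i = x by apply: val_inj => /=; lia.
  rewrite (_ : (p <= p + k < q)%N) /=; last by lia.
  move/negbT; rewrite -leqNgt; apply: leq_trans; apply: IH => //=; lia.
by apply: (H (q - p)%N) => //; lia.
Qed.

Lemma nodesc_id u : (forall i, ~~ desc i u) -> u = 1%g.
Proof.
move=> nd; apply: perm_lt_inj => p q; rewrite !perm1.
have mono (x y : 'I_n) : (x < y)%N -> (u x < u y)%N.
  move=> xy; have : u y <> u x :> nat by move/val_inj/perm_inj/(congr1 val) => /=; lia.
  suff : ~ (u y < u x)%N by lia.
  move/(between_drop xy (f := fun x => u x))=> [i _ hi].
  by have := nd i; rewrite /desc hi.
apply/idP/idP; last exact: mono.
apply: contraTT; rewrite -!leqNgt leq_eqVlt => /orP[/eqP e|/mono/ltnW//].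
by rewrite (val_inj e).
Qed.

(** [k] is fuel; [plength w] suffices, since each letter shortens [w]. The descent picked is
    arbitrary, which [TwE] makes harmless. *)
Fixpoint red_rec k w : seq 'I_n.-1 :=
  if k is k'.+1 then
    if [pick i | desc i w] is Some i then i :: red_rec k' (sgen i * w)%g else [::]
  else [::].

Definition red w := red_rec (plength w) w.

Lemma red_rec_id k w : (plength w <= k)%N -> red_rec k w = red w.
Proof.
rewrite /red; move: {2}(plength w) (leqnn (plength w)) => m.
elim: m w k => [|m IH] w k h1 h2.
  have -> : plength w = 0 by lia.
  case: k h2 => //= k h2; case: pickP => // i /plength_desc; lia.
case: k h2 => [|k] h2; first by have -> : plength w = 0%N by lia.
case E: (plength w) => [|l] /=; case: pickP => // i /plength_desc; first by lia.
by move=> H; congr (_ :: _); rewrite !IH //; lia.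
Qed.

Lemma red_cons w : w != 1%g -> exists2 i, desc i w & red w = i :: red (sgen i * w)%g.
Proof.
move=> w1; rewrite {1}/red.
case E: (plength w) => [|l] /=; last first.
  case: pickP => [i d|no]; last first.
    by case/eqP: w1; apply: nodesc_id => i; rewrite no.
  exists i => //; rewrite red_rec_id //.
  by have := plength_desc d; rewrite E.
case/eqP: w1; apply: nodesc_id => i; apply/negP => /plength_desc; lia.
Qed.

Lemma red1 : red 1%g = [::].
Proof.
rewrite /red; case: (plength _) => //= k; case: pickP => // i.
by rewrite /desc !perm1 /=; lia.
Qed.

End Coxeter.

(** * Operators satisfying the braid relations *)

Section HeckeOperators.
Variables (n : nat) (V : zmodType).
Implicit Types (t p : 'I_n.-1 -> V -> V) (i j : 'I_n.-1) (u v w : 'S_n) (x y : V).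

Record braided t : Prop := Braided {
  braidedB : forall i x y, t i (x - y) = t i x - t i y;
  braided_braid : forall i j x, j = i.+1 :> nat -> t i (t j (t i x)) = t j (t i (t j x));
  braided_comm : forall i j x, (i.+1 < j)%N -> t i (t j x) = t j (t i x) }.

Definition Tw t w x := foldr t x (red w).

Lemma braided0 t : braided t -> forall i, t i 0 = 0.
Proof. by move=> bt i; rewrite -[in t i 0](subrr 0) (braidedB bt) subrr. Qed.

Lemma braidedN t : braided t -> forall i x, t i (- x) = - t i x.
Proof. by move=> bt i x; rewrite -sub0r (braidedB bt) (braided0 bt) sub0r. Qed.

Lemma braidedD t : braided t -> forall i x y, t i (x + y) = t i x + t i y.
Proof. by move=> bt i x y; rewrite -{1}[y]opprK (braidedB bt) (braidedN bt) opprK. Qed.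

Lemma eq_braided t t' : (forall i x, t i x = t' i x) -> braided t -> braided t'.
Proof.
move=> e [b1 b2 b3]; split=> *; rewrite -!e; first exact: b1.
  exact: b2.
exact: b3.
Qed.

Lemma braided_opp t : braided t -> braided (fun i x => - t i x).
Proof.
move=> bt; split=> [i x y|i j x hij|i j x hij].
- by rewrite (braidedB bt) opprB opprK addrC.
- by rewrite !(braidedN bt) !opprK (braided_braid bt).
- by rewrite !(braidedN bt) !opprK (braided_comm bt).
Qed.

(** For idempotent p_i, (p_i - 1)(p_j - 1)(p_i - 1) = p_i p_j p_i - p_i p_j - p_j p_i + p_i + p_j -
    1, which is symmetric in i and j as soon as p_i p_j p_i is. *)
Lemma braided_pred p : braided p -> (forall i x, p i (p i x) = p i x) ->
  braided (fun i x => p i x - x) /\ forall i x, p i (p i x - x) - (p i x - x) = - (p i x - x).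
Proof.
move=> bp idem; split=> [|i x]; last by rewrite (braidedB bp) idem subrr sub0r.
split=> [i x y|i j x hij|i j x hij]; rewrite !(braidedB bp).
- by rewrite !opprB !addrA [LHS](ACl (1*4*3*2))%AC.
- rewrite !idem (braided_braid bp _ hij) !subrr !subr0 !opprB !addrA.
  by rewrite [RHS](ACl (1*6*5*4*3*2))%AC.
- rewrite (braided_comm bp _ hij) !opprB !addrA.
  by rewrite [RHS](ACl (1*4*3*2))%AC.
Qed.

Variable t : 'I_n.-1 -> V -> V.
Hypothesis bt : braided t.

Lemma Tw1 x : Tw t 1%g x = x.
Proof. by rewrite /Tw red1. Qed.

Lemma TwB w x y : Tw t w (x - y) = Tw t w x - Tw t w y.
Proof. by rewrite /Tw; elim: (red w) => //= i s ->; rewrite (braidedB bt). Qed.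

Lemma Tw0 w : Tw t w 0 = 0.
Proof. by rewrite /Tw; elim: (red w) => //= i s ->; rewrite (braided0 bt). Qed.

Lemma TwN w x : Tw t w (- x) = - Tw t w x.
Proof. by rewrite -sub0r TwB Tw0 sub0r. Qed.

(* Matsumoto's theorem: if [i] and [j] are two descents of [w], the longest
   element of the dihedral parabolic they generate is a left factor of [w]. *)
Lemma TwE i w x : desc i w -> Tw t w x = t i (Tw t (sgen i * w)%g x).
Proof.
have [m] := ubnP (plength w); elim: m i w => // m IH i w; rewrite ltnS => lw di.
have w1 : w != 1%g by apply: contraTneq di => ->; rewrite /desc !perm1 /=; lia.
have [j dj rw] := red_cons w1.
rewrite {1}/Tw rw /= -/(Tw t _ x).
wlog : i j di dj {rw} / (i <= j)%N => [H|ij].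
  by have [/H|/ltnW/H] := leqP i j; [apply | move=> -> //].
have IHi k u l : desc k w -> u = (sgen k * w)%g -> desc l u ->
    Tw t u x = t l (Tw t (sgen l * u)%g x).
  by move=> dk -> dl; apply: IH => //; apply: leq_trans (plength_desc dk) lw.
have IHii k u l u' l' : desc k w -> u = (sgen k * w)%g -> desc l u -> u' = (sgen l * u)%g ->
    desc l' u' -> Tw t u' x = t l' (Tw t (sgen l' * u')%g x).
  move=> dk -> dl -> dl'; apply: IH => //; apply: ltn_trans (plength_desc dl) _.
  exact: leq_trans (plength_desc dk) lw.
have [e|ne] := eqVneq i j; first by rewrite e.
have {}ij : (i < j)%N by rewrite ltn_neqAle ij -val_eqE in ne *; rewrite ne.
have [hij|hij] := ltnP i.+1 j.
  rewrite (IHi j (sgen j * w)%g i) ?desc_far_lo // (IHi i (sgen i * w)%g j) ?desc_far_hi //.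
  by rewrite -(braided_comm bt _ hij) !mulgA sgen_commute.
have {hij} e : j = i.+1 :> nat by lia.
have dij := desc_adj_trans e di dj.
have d1 : desc i (sgen j * w)%g by rewrite desc_adj_lo.
have d2 : desc j (sgen i * w)%g by rewrite desc_adj_hi.
rewrite (IHi j (sgen j * w)%g i) // (IHi i (sgen i * w)%g j) //.
rewrite (IHii j (sgen j * w)%g i (sgen i * (sgen j * w))%g j) ?desc_adj_hilo //.
rewrite (IHii i (sgen i * w)%g j (sgen j * (sgen i * w))%g i) ?desc_adj_lohi //.
by rewrite -(braided_braid bt _ e) !mulgA -sgen_braid.
Qed.


(* Right-handed version of [TwE]; only descents are compared, so that no
   exchange property is needed. *)
Lemma TwS i v x : i \notin rdesc v -> Tw t (v * sgen i)%g x = Tw t v (t i x).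
Proof.
have [m] := ubnP (plength v); elim: m v => // m IH v; rewrite ltnS => lv ndi.
have [->|v1] := eqVneq v 1%g.
  by rewrite mul1g Tw1 (@TwE i) ?sgenK ?Tw1 // /desc sgen_lo sgen_hi /=.
have [j dj _] := red_cons v1.
rewrite (@TwE j (v * _)%g) ?(@TwE j v) // ?mulgA ?IH //.
- exact: leq_trans (plength_desc dj) lv.
- move: ndi; rewrite !inE invMg sgenV !permM -!leqNgt => h.
  have {}h : ((v^-1)%g (gen_lo i) < (v^-1)%g (gen_hi i))%N.
    by rewrite ltn_neqAle h andbT; apply/eqP/perm_lo_hi.
  apply: ltnW; apply: sgen_lt => //; apply/negP=> /andP[/eqP e1 /eqP e2].
  have e3 : (v^-1)%g (gen_lo i) = gen_lo j by apply: val_inj.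
  have e4 : (v^-1)%g (gen_hi i) = gen_hi j by apply: val_inj.
  by move: dj; rewrite /desc -e3 -e4 !permKV /= ltnNge leqnSn.
- rewrite /desc !permM; apply: sgen_lt => //; apply/negP=> /andP[/eqP e1 /eqP e2].
  move: ndi; rewrite inE.
  have -> : gen_hi i = v (gen_lo j) by apply: val_inj; rewrite /= e2.
  have -> : gen_lo i = v (gen_hi j) by apply: val_inj; rewrite /= e1.
  by rewrite !permK /= ltnS leqnn.
Qed.

Hypothesis tq : forall i x, t i (t i x) = - t i x.

Lemma Tw_rdesc i w x : i \in rdesc w -> Tw t w (t i x) = - Tw t w x.
Proof.
move=> iw; have E : w = (w * sgen i * sgen i)%g by rewrite -mulgA sgenK mulg1.
have ni : i \notin rdesc (w * sgen i)%g by rewrite rdesc_mulg negbK.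
by move: (w * sgen i)%g E ni => v -> nv; rewrite !TwS // tq TwN.
Qed.

Lemma gen_Tw i w x :
  t i (Tw t w x) = if desc i w then - Tw t w x else Tw t (sgen i * w)%g x.
Proof.
case: ifPn => d; first by rewrite (TwE x d) tq.
by rewrite (@TwE i (_ * _)%g) ?desc_sgenM // mulgA sgenK mul1g.
Qed.

(** A product of generators of the 0-Hecke algebra is a basis element up to sign. Both [w] and the
    sign are chosen before [x], so one word can be tested on several vectors. *)
Lemma word_Tw s : exists w e, forall x, foldr t x s = if e then - Tw t w x else Tw t w x.
Proof.
elim: s => [|i s [w [e IH]]]; first by exists 1%g, false => x; rewrite Tw1.
exists (if desc i w then w else (sgen i * w)%g), (e (+) desc i w) => x.
rewrite /= IH; case: e {IH}; rewrite /= ?(braidedN bt) gen_Tw; case: ifP => //=; by rewrite ?opprK.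
Qed.

Lemma Tw_word w s x : all (mem (rdesc w)) s ->
  Tw t w (foldr t x s) = if odd (size s) then - Tw t w x else Tw t w x.
Proof.
elim: s => //= i s IH /andP[iw sw]; rewrite Tw_rdesc // IH //.
by case: (odd _); rewrite /= ?opprK.
Qed.

End HeckeOperators.

(* The word [W k] spells the longest element of the parabolic generated by the
   [j < k] with [P j]; for idempotent braided operators its product absorbs
   each of these generators on either side. *)
Section Absorption.
Variables (V : Type) (P : pred nat) (p : nat -> V -> V).
Hypothesis idem : forall k x, P k -> p k (p k x) = p k x.
Hypothesis braid : forall k x, P k -> P k.+1 ->
  p k (p k.+1 (p k x)) = p k.+1 (p k (p k.+1 x)).
Hypothesis comm : forall j k x, P j -> P k -> (j.+1 < k)%N -> p j (p k x) = p k (p j x).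
Implicit Types (x : V) (s : seq nat).

Let F s x := foldr p x s.
Let W k := flatten [seq downrun P j | j <- iota 0 k & P j].

Lemma absorb_cat s1 s2 x : F (s1 ++ s2) x = F s1 (F s2 x).
Proof. exact: foldr_cat. Qed.

Lemma downrunS k : P k.+1 -> downrun P k.+1 = k.+1 :: downrun P k.
Proof. by move=> /= ->. Qed.

Lemma downrunN k : ~~ P k -> downrun P k = [::].
Proof. by case: k => [|k] /= /negbTE->. Qed.

Lemma downrun_cons k : P k -> downrun P k = k :: behead (downrun P k).
Proof. by case: k => [|k] /= ->. Qed.

Lemma mem_downrun k j : j \in downrun P k -> P j && (j <= k)%N.
Proof.
elim: k => [|k IH] /=; case: ifP => // Pk; rewrite in_cons => /orP[/eqP->|]; rewrite ?Pk //=.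
by move=> /IH /andP[-> /=]; lia.
Qed.

Lemma mem_behead_downrun k j : j \in behead (downrun P k) -> P j && (j < k)%N.
Proof. by case: k => [|k] /=; case: ifP => //= _ /mem_downrun; rewrite ltnS. Qed.

Lemma absorb_word k : W k.+1 = W k ++ downrun P k.
Proof.
rewrite /W -[k.+1]addn1 iotaD add0n filter_cat map_cat flatten_cat /=.
by case: ifPn => [|/downrunN->]; rewrite /= ?cats0.
Qed.

Lemma mem_absorb_word k j : j \in W k -> P j && (j < k)%N.
Proof.
elim: k => // k IH; rewrite absorb_word mem_cat => /orP[/IH/andP[-> /=]|/mem_downrun]; by lia.
Qed.

Lemma absorb_comm k s x : P k -> {in s, forall j, P j && (j.+1 < k)%N} ->
  p k (F s x) = F s (p k x).
Proof.
move=> Pk; elim: s => //= j s IH H.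
have /andP[Pj jk] : P j && (j.+1 < k)%N by apply: H; rewrite mem_head.
by rewrite -comm // IH // => l ls; apply: H; rewrite in_cons ls orbT.
Qed.

(** Serves [absorb_left] for the newest generator: after passing the earlier runs it completes the
    run below it to a second copy of the last run, and this copy loses its first letter again. *)
Lemma absorb_downrun2 k x : P k ->
  F (downrun P k) (F (downrun P k) x) = F (behead (downrun P k)) (F (downrun P k) x).
Proof.
elim: k x => [|k IH] x Pk; first by rewrite /= Pk /= idem.
rewrite downrunS //=; case: (boolP (P k)) => [Pk'|/downrunN-> /=]; last exact: idem.
set E := behead (downrun P k).
have EE : downrun P k = k :: E by exact: downrun_cons.
have cE y : p k.+1 (F E y) = F E (p k.+1 y).
  apply: absorb_comm => // j; rewrite /E => /mem_behead_downrun; by lia.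
set y := foldr p x (downrun P k).
rewrite {1}EE /= -/(F E _) -cE -braid //.
have -> : p k (F E y) = F E y by have := IH x Pk'; rewrite {1}EE.
by rewrite cE /y EE.
Qed.

Lemma absorb_left k i x : (i < k)%N -> P i -> p i (F (W k) x) = F (W k) x.
Proof.
elim: k x => // k IH x; rewrite ltnS leq_eqVlt => /orP[/eqP->|ik] Pi; last first.
  by rewrite absorb_word absorb_cat IH.
rewrite absorb_word absorb_cat; case: k {IH i} Pi => [|k] Pk; first by rewrite /= Pk /= idem.
rewrite absorb_word absorb_cat absorb_comm //; last first.
  by move=> j /mem_absorb_word; lia.
congr (F _ _); have := absorb_downrun2 x Pk.
by rewrite downrunS.
Qed.

(** By the braid relation p_i leaves the run on the left as p_{i-1}; the bottom letter of the run is
    absorbed, and a letter below the run commutes through. The index that comes out is less than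
    [k], so the earlier runs can absorb it. *)
Lemma absorb_downrun_right k i : P k -> P i -> (i <= k)%N ->
  (forall x, F (downrun P k) (p i x) = F (downrun P k) x) \/
  exists2 j, P j && (j < k)%N & forall x, F (downrun P k) (p i x) = p j (F (downrun P k) x).
Proof.
elim: k i => [|k IH] i Pk Pi.
  by rewrite leqn0 => /eqP->; left => x /=; rewrite Pk /= idem.
rewrite leq_eqVlt => /orP[/eqP->|]; rewrite downrunS //.
  case: (boolP (P k)) => [Pk'|/downrunN->]; last by left => x /=; rewrite idem.
  right; exists k => [|x]; first by rewrite Pk' /=.
  rewrite downrun_cons //= -/(F _ _) -absorb_comm // => [|j /mem_behead_downrun]; last by lia.
  by rewrite braid.
rewrite ltnS => ik; case: (boolP (P k)) => [Pk'|nPk].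
  have [H|[j /andP[Pj jk] H]] := IH i Pk' Pi ik; first by left => x /=; rewrite -!/(F _ _) H.
  right; exists j => [|x /=]; first by rewrite Pj ltnW.
  by rewrite -!/(F _ _) H -comm.
right; exists i => [|x]; first by rewrite Pi ltnS.
rewrite (downrunN nPk) /= -comm //; move: ik; rewrite leq_eqVlt => /orP[/eqP e|//].
by rewrite e (negbTE nPk) in Pi.
Qed.

Lemma absorb_right k i x : (i < k)%N -> P i -> F (W k) (p i x) = F (W k) x.
Proof.
elim: k i x => // k IH i x; rewrite ltnS absorb_word !absorb_cat => ik Pi.
case: (boolP (P k)) => [Pk|nPk]; last first.
  rewrite downrunN //=; apply: IH => //; rewrite ltn_neqAle ik andbT.
  by apply: contraNneq nPk => <-.
have [->//|[j /andP[Pj jk] ->]] := absorb_downrun_right Pk Pi ik.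
exact: IH.
Qed.

End Absorption.

(** * Absorption for the longest element of a parabolic subgroup *)

Section LongestWord.
Variables (n : nat) (V : zmodType) (p : 'I_n.-1 -> V -> V).
Hypothesis bp : braided p.
Hypothesis idem : forall i x, p i (p i x) = p i x.
Variable J : {set 'I_n.-1}.

Let P := fun k : nat => [exists x in J, val x == k].
(** Numbers that are no generator index act as the identity, in agreement with [pmap insub] dropping
    them. *)
Let q (k : nat) : V -> V := if insub k is Some i then p i else id.

Lemma longest_mem (i : 'I_n.-1) : P i = (i \in J).
Proof.
apply/existsP/idP => [[x /andP[xJ /eqP/val_inj<-]]//|iJ].
by exists i; rewrite iJ /=.
Qed.

Lemma longest_insub k : P k -> exists2 i, i \in J & k = i :> nat.
Proof. by case/existsP=> x /andP[xJ /eqP<-]; exists x. Qed.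

Lemma longest_ord (i : 'I_n.-1) : q i = p i.
Proof. by rewrite /q valK. Qed.

Lemma foldr_pmap_insub s x : foldr p x (pmap insub s) = foldr q x s.
Proof. by elim: s => //= k s <-; rewrite /q; case: insubP. Qed.

Lemma longest_idem k x : P k -> q k (q k x) = q k x.
Proof. by case/longest_insub=> i _ ->; rewrite longest_ord idem. Qed.

Lemma longest_braid k x : P k -> P k.+1 -> q k (q k.+1 (q k x)) = q k.+1 (q k (q k.+1 x)).
Proof.
case/longest_insub=> i _ ei /longest_insub[j _ ej]; rewrite ej ei !longest_ord.
by rewrite (braided_braid bp) // -ej ei.
Qed.

Lemma longest_comm j k x : P j -> P k -> (j.+1 < k)%N -> q j (q k x) = q k (q j x).
Proof.
case/longest_insub=> i _ -> /longest_insub[l _ ->] h.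
by rewrite !longest_ord (braided_comm bp).
Qed.

Lemma w0word_left i x : i \in J -> p i (foldr p x (w0word J)) = foldr p x (w0word J).
Proof.
move=> iJ; rewrite foldr_pmap_insub -(longest_ord i).
apply: (absorb_left longest_idem longest_braid longest_comm) => //.
by rewrite longest_mem.
Qed.

Lemma w0word_right i x : i \in J -> foldr p (p i x) (w0word J) = foldr p x (w0word J).
Proof.
move=> iJ; rewrite !foldr_pmap_insub -(longest_ord i).
apply: (absorb_right longest_idem longest_braid longest_comm) => //.
by rewrite longest_mem.
Qed.

End LongestWord.

Lemma w0word_sub n (J : {set 'I_n.-1}) : {subset w0word J <= J}.
Proof.
move=> i; rewrite mem_pmap_sub => /mem_absorb_word/andP[/existsP[x /andP[xJ /eqP/val_inj<-]]] //.
Qed.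

(** * The regular module and its projective summands *)

Section RegularModule.
Variables (F : fieldType) (n : nat).
Implicit Types (i j : 'I_n.-1) (u v w : 'S_n) (c d : Hreg F n) (J : {set 'I_n.-1}).

(* [T'_i] acts on coordinate functions by precomposing with the operation
   that sorts the positions [i] and [i + 1]. *)
Definition sort2 i u := if desc i u then (sgen i * u)%g else u.

Lemma HregB c d u : (c - d) u = c u - d u.
Proof. by rewrite !ffunE. Qed.

Lemma TactE i c u : Tact i c u = if desc i u then c (sgen i * u)%g - c u else 0.
Proof. by rewrite ffunE plengthE. Qed.

Lemma TpactE i c u : Tpact i c u = c (sort2 i u).
Proof. by rewrite ffunE TactE /sort2; case: ifP; rewrite ?subrK ?add0r. Qed.

Lemma sort2_id i u : sort2 i (sort2 i u) = sort2 i u.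
Proof. by rewrite /sort2; case: (boolP (desc i u)) => d; rewrite ?desc_sgenM ?d //= (negbTE d). Qed.

(** Both sides sort the values at the three consecutive positions completely. *)
Lemma sort2_braid i j u : j = i.+1 :> nat ->
  sort2 i (sort2 j (sort2 i u)) = sort2 j (sort2 i (sort2 j u)).
Proof.
move=> hij; rewrite /sort2.
have tr := @desc_adj_trans _ i j hij u.
case di: (desc i u); case dj: (desc j u);
  rewrite ?di ?dj ?(desc_adj_hi hij) ?(desc_adj_lo hij) ?di ?dj.
- rewrite tr // (desc_adj_lohi hij) (desc_adj_hilo hij) di dj !mulgA.
  by rewrite sgen_braid.
- case: (u (gen_hi j) < u (gen_lo i))%N; last by rewrite desc_sgenM di.
  by rewrite (desc_adj_lohi hij) dj.
- case: (u (gen_hi j) < u (gen_lo i))%N; last by rewrite desc_sgenM dj.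
  by rewrite (desc_adj_hilo hij) di.
- by [].
Qed.

Lemma sort2_comm i j u : (i.+1 < j)%N -> sort2 i (sort2 j u) = sort2 j (sort2 i u).
Proof.
move=> hij; rewrite /sort2; case di: (desc i u); case dj: (desc j u);
  rewrite ?di ?dj ?(desc_far_lo _ hij) ?(desc_far_hi _ hij) ?di ?dj //.
by rewrite !mulgA sgen_commute.
Qed.

Lemma Tpact_idem i c : Tpact i (Tpact i c) = Tpact i c.
Proof. by apply/ffunP=> u; rewrite !TpactE sort2_id. Qed.

Lemma braided_Tpact : braided (@Tpact F n).
Proof.
split=> [i c d|i j c hij|i j c hij]; apply/ffunP=> u.
- by rewrite HregB !TpactE HregB.
- by rewrite !TpactE (sort2_braid _ hij).
- by rewrite !TpactE (sort2_comm _ hij).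
Qed.

Lemma Tact_Tpact i c : Tpact i c - c = Tact i c.
Proof. by apply/ffunP=> u; rewrite !ffunE addrK. Qed.

Lemma braided_Tact : braided (@Tact F n).
Proof. exact: eq_braided Tact_Tpact (braided_pred braided_Tpact Tpact_idem).1. Qed.

Lemma Tact_quad i c : Tact i (Tact i c) = - Tact i c.
Proof. by rewrite -!Tact_Tpact (braided_pred braided_Tpact Tpact_idem).2. Qed.

Definition scalef (a : F) c : Hreg F n := [ffun u => a * c u].

Lemma scalefE a c u : scalef a c u = a * c u.
Proof. by rewrite ffunE. Qed.

Lemma TactZ a i c : Tact i (scalef a c) = scalef a (Tact i c).
Proof. by apply/ffunP=> u; rewrite scalefE !TactE !scalefE; case: ifP; rewrite ?mulr0 ?mulrBr. Qed.

Lemma Tw_Hone w : Tw (@Tact F n) w (Hone F n) = [ffun u => (u == w)%:R].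
Proof.
have [m] := ubnP (plength w); elim: m w => // m IH w; rewrite ltnS => lw.
have [->|w1] := eqVneq w 1%g.
  by rewrite Tw1; apply/ffunP=> u; rewrite !ffunE; case: eqP.
have [i di _] := red_cons w1.
rewrite (TwE braided_Tact _ di) IH; last exact: leq_trans (plength_desc di) lw.
apply/ffunP=> u; rewrite TactE !ffunE.
have [->|uw] := eqVneq u w; rewrite ?(can_eq (mulKg _)) ?eqxx ?(negbTE uw).
  by rewrite di (_ : (w == _) = false) ?subr0 //; apply/negP => /eqP/(congr1 (desc i)); rewrite desc_sgenM di.
case: ifP => // du; rewrite (_ : (u == _) = false) ?subr0 //.
by apply: contraTF du => /eqP->; rewrite desc_sgenM di.
Qed.

(* [Hmor] is the module morphism from the regular module sending [Hone] to [y]. *)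
Section FreeModule.
Variables (V : lmodType F) (t : 'I_n.-1 -> V -> V) (y : V).
Hypothesis bt : braided t.
Hypothesis tq : forall i x, t i (t i x) = - t i x.
Hypothesis tZ : forall i (a : F) x, t i (a *: x) = a *: t i x.

Definition Hmor c := \sum_w c w *: Tw t w y.

Lemma Hmor_lin a c d : Hmor [ffun u => a * c u + d u] = a *: Hmor c + Hmor d.
Proof.
rewrite /Hmor scaler_sumr -big_split /=; apply: eq_bigr => w _.
by rewrite ffunE scalerDl scalerA.
Qed.

(** For [w] with left descent [i], the terms of [t i (Hmor c)] at [w] and at s_i w are both
    multiples of T_w y; their total coefficient is the value of [Tact i c] at [w]. *)
Lemma Hmor_Tact i c : Hmor (Tact i c) = t i (Hmor c).
Proof.
have tS (I : finType) (f : I -> V) : t i (\sum_k f k) = \sum_k t i (f k).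
  by apply: (big_morph _ (braidedD bt i) (braided0 bt i)).
rewrite /Hmor tS.
rewrite (bigID (desc i)) /= [X in _ + X]big1 ?addr0; last first.
  by move=> w /negbTE dw; rewrite TactE dw scale0r.
rewrite [RHS](bigID (desc i)) /= addrC.
rewrite [X in _ = X + _](reindex_inj (mulgI (sgen i))) /=.
under [X in _ = X + _]eq_bigl => w do rewrite desc_sgenM negbK.
rewrite -big_split /=; apply: eq_bigr => w dw.
rewrite TactE dw !tZ !(gen_Tw bt tq) dw desc_sgenM dw /= mulgA sgenK mul1g.
by rewrite scalerBl scalerN.
Qed.

Lemma Hmor_word s c : Hmor (applyT s c) = foldr t (Hmor c) s.
Proof. by elim: s => //= i s <-; rewrite Hmor_Tact. Qed.

Lemma Hmor_Hone : Hmor (Hone F n) = y.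
Proof.
rewrite /Hmor (bigD1 1%g) //= big1 ?addr0 ?ffunE ?eqxx ?Tw1 ?scale1r // => w /negbTE w1.
by rewrite ffunE w1 scale0r.
Qed.

Lemma Hmor_applyTp s : {in s, forall i, t i y = 0} -> Hmor (applyTp s (Hone F n)) = y.
Proof.
elim: s => [|i s IH] H; first exact: Hmor_Hone.
have {}IH : Hmor (applyTp s (Hone F n)) = y by apply: IH => j js; apply: H; rewrite in_cons js orbT.
rewrite /= -/(applyTp s _) -[Tpact i _](subrK (applyTp s (Hone F n))) Tact_Tpact.
have -> c d : c + d = [ffun u => 1 * c u + d u] :> Hreg F n.
  by apply/ffunP=> u; rewrite !ffunE mul1r.
by rewrite Hmor_lin Hmor_Tact IH H ?mem_head // scaler0 add0r.
Qed.

End FreeModule.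

Definition projE J := applyTp (w0word (~: J)) (Hone F n).
Definition projB J w : Hreg F n := Tw (@Tact F n) w (projE J).

Lemma inP_lin J a c d : inP J c -> inP J d -> inP J [ffun u => a * c u + d u].
Proof.
move=> [s ->] [r ->]; exists ([seq (a * q.1, q.2) | q <- s] ++ r).
rewrite big_cat big_map /=; apply/ffunP=> u; rewrite !ffunE !sum_ffunE; congr (_ + _).
by rewrite mulr_sumr; apply: eq_bigr => q _; rewrite !ffunE mulrA.
Qed.

Lemma inP0 J : inP J (0 : Hreg F n).
Proof. by exists [::]; rewrite big_nil. Qed.

Lemma inP_gen J s : inP J (applyT s (projgen F J)).
Proof. by exists [:: (1, s)]; rewrite big_seq1; apply/ffunP=> u; rewrite ffunE mul1r. Qed.

Lemma inP_opp J c : inP J c -> inP J (- c).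
Proof.
move=> /(inP_lin (-1))/(_ (inP0 J)); congr inP.
by apply/ffunP=> u; rewrite !ffunE mulN1r addr0.
Qed.

Lemma inP_ind J (Q : Hreg F n -> Prop) : Q 0 ->
  (forall a c d, Q c -> Q d -> Q [ffun u => a * c u + d u]) ->
  (forall s, Q (applyT s (projgen F J))) -> forall c, inP J c -> Q c.
Proof.
move=> Q0 QD Qs c [s ->]; elim: s => [|[a s] r IH]; first by rewrite big_nil.
rewrite big_cons /=; set d := \sum_(p <- r) _ in IH *.
have -> : [ffun u => a * applyT s (projgen F J) u] + d =
          [ffun u => a * applyT s (projgen F J) u + d u] :> Hreg F n.
  by apply/ffunP=> u; rewrite !ffunE.
exact: QD.
Qed.

Lemma inP_Tact J i c : inP J c -> inP J (Tact i c).
Proof.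
move: c; apply: inP_ind => [|a c d hc hd|s].
- by rewrite (braided0 braided_Tact); apply: inP0.
- have -> : Tact i [ffun u => a * c u + d u] = [ffun u => a * Tact i c u + Tact i d u].
    have -> : [ffun u => a * c u + d u] = scalef a c + d by apply/ffunP=> u; rewrite !ffunE.
    by rewrite (braidedD braided_Tact) TactZ; apply/ffunP=> u; rewrite !ffunE.
  exact: inP_lin.
- exact: (inP_gen J (i :: s)).
Qed.

(* For [i] in [rdesc w], right multiplication of [T_w] by [T_i] is [-T_w], so
   inserting the word of [w0(J)] only changes the sign. *)
Lemma inP_projB w : inP (rdesc w) (projB (rdesc w) w).
Proof.
have sw : all (mem (rdesc w)) (w0word (rdesc w)) by apply/allP=> i; apply: w0word_sub.
have := Tw_word braided_Tact Tact_quad (projE (rdesc w)) sw.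
have -> : Tw (@Tact F n) w (foldr (@Tact F n) (projE (rdesc w)) (w0word (rdesc w))) =
          applyT (red w) (projgen F (rdesc w)) by [].
move: (inP_gen (rdesc w) (red w)); rewrite -/(projB _ _); case: (odd _) => [|] h e.
  by rewrite -[projB _ _]opprK -e; apply: inP_opp.
by rewrite -e.
Qed.

(** The operators -T_i are braided and idempotent, so absorption applies to them; returning to T_i
    costs the sign. *)
Lemma Tact_w0word_right J i c : i \in J ->
  applyT (w0word J) (Tact i c) = - applyT (w0word J) c.
Proof.
move=> iJ; pose q k c := - Tact k c : Hreg F n.
have qT s c' : foldr q c' s = if odd (size s) then - applyT s c' else applyT s c'.
  elim: s => //= k s ->; rewrite /q; case: (odd _) => /=; last by [].
  by rewrite (braidedN braided_Tact) opprK.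
have qid k x : q k (q k x) = q k x by rewrite /q (braidedN braided_Tact) opprK Tact_quad.
have aN s : applyT s (- Tact i c) = - applyT s (Tact i c).
  by elim: s => //= k s ->; rewrite (braidedN braided_Tact).
have := w0word_right (braided_opp braided_Tact) qid c iJ.
rewrite !qT /q aN opprK; case: (odd _) => // <-; by rewrite opprK.
Qed.

Lemma Tp_projE J i : i \notin J -> Tact i (projE J) = 0.
Proof.
rewrite -in_setC => iJ; rewrite -Tact_Tpact.
by rewrite [Tpact i _](w0word_left braided_Tpact Tpact_idem _ iJ) subrr.
Qed.

Lemma projB_eq0 J w i : i \in rdesc w -> i \notin J -> projB J w = 0.
Proof.
move=> iw iJ; have := Tw_rdesc braided_Tact Tact_quad (projE J) iw.
by rewrite Tp_projE // (Tw0 braided_Tact) -/(projB J w) => /eqP; rewrite eq_sym oppr_eq0 => /eqP.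
Qed.

(** If some i in J were not a right descent of [w], comparing the word on T_i and on 1 would give
    T_{w s_i} = -T_w, against the independence of the T_w. *)
Lemma rdesc_w0word J s w e :
  (forall c, applyT (s ++ w0word J) c = if e then - Tw (@Tact F n) w c else Tw (@Tact F n) w c) ->
  J \subset rdesc w.
Proof.
move=> H; apply/subsetP=> i iJ; apply: contraT => iw.
have := H (Tact i (Hone F n)); rewrite /applyT foldr_cat -!/(applyT _ _).
rewrite Tact_w0word_right // -(TwS braided_Tact) //.
have aN r (c : Hreg F n) : applyT r (- c) = - applyT r c.
  by elim: r => //= k r ->; rewrite (braidedN braided_Tact).
rewrite aN /applyT -foldr_cat -/(applyT _ _) H => E.
have {E} : Tw (@Tact F n) (w * sgen i)%g (Hone F n) = - Tw (@Tact F n) w (Hone F n).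
  by case: e {H} E => [/oppr_inj<-|<-]; rewrite ?opprK.
rewrite !Tw_Hone => /ffunP/(_ (w * sgen i)%g); rewrite !ffunE eqxx.
rewrite (_ : (_ == w) = false) ?oppr0 => [/eqP|]; first by rewrite oner_eq0.
by apply/negP=> /eqP/(congr1 (fun v => i \in rdesc v)); rewrite rdesc_mulg iw (negbTE iw).
Qed.

(** A word followed by that of w0(J) collapses to T_w up to sign, with J inside D(w); on [projE J]
    this vanishes unless D(w) is also inside J. *)
Lemma inP_projB_span J c : inP J c ->
  exists a : 'S_n -> F, c = \sum_(w | rdesc w == J) scalef (a w) (projB J w).
Proof.
move: c; apply: inP_ind => [|a c d [f ->] [g ->]|s].
- exists (fun=> 0); rewrite big1 // => w _; apply/ffunP=> u; by rewrite !ffunE mul0r.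
- exists (fun w => a * f w + g w); apply/ffunP=> u; rewrite ffunE !sum_ffunE mulr_sumr -big_split /=.
  by apply: eq_bigr => w _; rewrite !ffunE mulrDl mulrA.
have [w [e H]] := word_Tw braided_Tact Tact_quad (s ++ w0word J).
have Jw := rdesc_w0word H.
have := H (projE J); rewrite foldr_cat -[LHS]/(applyT s (projgen F J)) -/(projB J w) => ->.
have [E|ne] := eqVneq (rdesc w) J; last first.
  have [i iw iJ] : exists2 i, i \in rdesc w & i \notin J.
    by apply/subsetPn; apply: contraNN ne => h; rewrite eqEsubset h.
  exists (fun=> 0); rewrite big1 => [|v _]; last by apply/ffunP=> u; rewrite !ffunE mul0r.
  by rewrite (projB_eq0 iw iJ) oppr0; case: e {H}.
exists (fun v => if v == w then if e then -1 else 1 else 0).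
rewrite (bigD1 w) ?E //= eqxx big1 => [|v /andP[_ /negbTE->]]; last first.
  by apply/ffunP=> u; rewrite !ffunE mul0r.
by rewrite addr0; apply/ffunP=> u; case: e {H}; rewrite !ffunE ?mulN1r ?mul1r.
Qed.

End RegularModule.

(** * Isobaric Demazure operators *)

Section Demazure.
Variables (F : fieldType) (n : nat).
Implicit Types (i j : 'I_n.-1) (f g : {mpoly F[n]}) (m : 'X_{1..n}).

Local Notation lo := gen_lo.
Local Notation hi := gen_hi.
Local Notation VX p := ('X_p : {mpoly F[n]}).
Local Notation s i f := (msym (sgen i) f).

Lemma lo_hiF i : (lo i == hi i) = false.
Proof. by rewrite -val_eqE /= ltn_eqF. Qed.

Lemma lo_hi_neq0 i : VX (lo i) - VX (hi i) != 0.
Proof.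
rewrite subr_eq0; apply/negP=> /eqP/(congr1 (fun f : {mpoly F[n]} => f@_U_(lo i)%MM)).
rewrite !mcoeffX eqxx; case: eqP => [/(congr1 (fun m => m (lo i)))|_ /eqP].
  by rewrite !mnm1E eqxx eq_sym lo_hiF.
by rewrite oner_eq0.
Qed.

Lemma sgen_sq i f : s i (s i f) = f.
Proof. by rewrite -msymMm sgenK msym1m. Qed.

Lemma sgen_X i p : s i (VX p) = VX (sgen i p).
Proof.
rewrite msymX sgenV; congr 'X_[_]; apply/mnmP=> q; rewrite mnmE !mnm1E.
by rewrite -(can_eq (sgenKp i)) sgenKp.
Qed.

Definition setm i m a b : 'X_{1..n} :=
  [multinom if p == lo i then a else if p == hi i then b else m p | p < n].

Lemma setmE i m a b p :
  setm i m a b p = if p == lo i then a else if p == hi i then b else m p.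
Proof. exact: mnmE. Qed.

Lemma setm_id i m : setm i m (m (lo i)) (m (hi i)) = m.
Proof. by apply/mnmP=> p; rewrite setmE; case: eqP => [->//|_]; case: eqP => [->|]. Qed.

Lemma setmX i m a b :
  'X_[setm i m a b] = 'X_[setm i m 0 0] * VX (lo i) ^+ a * VX (hi i) ^+ b :> {mpoly F[n]}.
Proof.
rewrite !mpolyXn -!mpolyXD; congr 'X_[_]; apply/mnmP=> p.
rewrite !mnmDE !mulmnE !mnm1E !setmE ![_ == p]eq_sym.
case: eqP => [->|_]; rewrite ?lo_hiF ?mul0n ?mul1n ?addn0 //.
by case: eqP => _; rewrite ?mul0n ?mul1n ?addn0.
Qed.

Lemma sgen_setm i m a b : s i 'X_[setm i m a b] = 'X_[setm i m b a] :> {mpoly F[n]}.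
Proof.
rewrite msymX sgenV; congr 'X_[_]; apply/mnmP=> p; rewrite mnmE !setmE.
rewrite -[sgen i p == lo i](can_eq (sgenKp i)) -[sgen i p == hi i](can_eq (sgenKp i)).
rewrite sgenKp sgen_lo sgen_hi; case: eqP => [->|p1]; first by rewrite eq_sym lo_hiF.
case: eqP => // p2; rewrite sgen_id //; apply/eqP => e; [apply: p2|apply: p1]; exact: val_inj.
Qed.

(* The monomials strictly between [m] and its [s_i]-image on the [i]-string. *)
Definition string i m : {mpoly F[n]} :=
  let c := minn (m (lo i)) (m (hi i)) in
  let l := (maxn (m (lo i)) (m (hi i)) - c)%N in
  \sum_(t < l.-1) 'X_[setm i m (c + (l.-1 - t)) (c + t.+1)].

Definition piX i m : {mpoly F[n]} :=
  if (m (hi i) < m (lo i))%N then 'X_[m] + string i m + s i 'X_[m]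
  else if m (hi i) == m (lo i) then 'X_[m] else - string i m.

Lemma string_telescope i m : m (lo i) <> m (hi i) ->
  (VX (lo i) - VX (hi i)) * string i m =
  'X_[setm i m (maxn (m (lo i)) (m (hi i))) (minn (m (lo i)) (m (hi i)))] * VX (hi i) -
  'X_[setm i m (minn (m (lo i)) (m (hi i))) (maxn (m (lo i)) (m (hi i)))] * VX (lo i).
Proof.
move=> ne; rewrite /string; set c := minn _ _; set l := (_ - c)%N.
have -> : maxn (m (lo i)) (m (hi i)) = (c + l.-1.+1)%N.
  by rewrite /l /c; move: ne; lia.
rewrite [X in _ = X * _ - _]setmX [X in _ = _ - X * _]setmX !exprD !exprS.
set M : {mpoly F[n]} := 'X_[setm i m 0 0]; move: (l.-1) => k.
under eq_bigr => t _.
  rewrite setmX !exprD exprS -/M.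
  have -> : M * (VX (lo i) ^+ c * VX (lo i) ^+ (k - t)) * (VX (hi i) ^+ c * (VX (hi i) * VX (hi i) ^+ t)) =
    (M * VX (lo i) ^+ c * VX (hi i) ^+ c * VX (hi i)) * VX (lo i) * (VX (lo i) ^+ (k.-1 - t) * VX (hi i) ^+ t).
    have -> : (k - t = (k.-1 - t).+1)%N by case: k t => [[]//|k] t /=; rewrite subSn // -ltnS.
    by rewrite exprS; ring.
  over.
rewrite -big_distrr /= mulrCA -subrXX; ring.
Qed.

Lemma piX_quotient i m :
  (VX (lo i) - VX (hi i)) * piX i m = VX (lo i) * 'X_[m] - VX (hi i) * s i 'X_[m].
Proof.
rewrite /piX -{3 5}(setm_id i m).
have := string_telescope (i := i) (m := m).
rewrite -[in 'X_[m]](setm_id i m).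
case: ltngtP => [lt|gt|e] H.
- rewrite !mulrDr H; last by lia.
  by rewrite sgen_setm; ring.
- rewrite mulrN H; last by lia.
  by rewrite sgen_setm; ring.
- rewrite e sgen_setm; ring.
Qed.

(** The choice operator yields the equation only once a quotient exists: [piX] on monomials,
    extended linearly. *)
Lemma pi_opP i f : (VX (lo i) - VX (hi i)) * pi_op i f = VX (lo i) * f - VX (hi i) * s i f.
Proof.
apply: (epsilon_spec (inhabits 0) (fun g => (VX (lo i) - VX (hi i)) * g = VX (lo i) * f - VX (hi i) * s i f)).
elim/mpolyind: f => [|c m f _ _ [g hg]].
  by exists 0; rewrite msym0 !mulr0 subr0.
exists (c *: piX i m + g); rewrite mulrDr hg -scalerAr piX_quotient msymD msymZ.
rewrite scalerBr !mulrDr -!scalerAr; ring.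
Qed.

Lemma pi_op_unique i f g :
  (VX (lo i) - VX (hi i)) * g = VX (lo i) * f - VX (hi i) * s i f -> pi_op i f = g.
Proof. by move=> h; apply: (mulfI (lo_hi_neq0 i)); rewrite pi_opP. Qed.

Lemma pi_op_mon i m : pi_op i 'X_[m] = piX i m.
Proof. exact/pi_op_unique/piX_quotient. Qed.

Lemma pi_opZ i a f : pi_op i (a *: f) = a *: pi_op i f.
Proof.
by apply: pi_op_unique; rewrite -scalerAr pi_opP msymZ scalerBr !scalerAr.
Qed.

Lemma pi_opB i f g : pi_op i (f - g) = pi_op i f - pi_op i g.
Proof. by apply: pi_op_unique; rewrite mulrBr !pi_opP msymB; ring. Qed.

Lemma pi_op_mull i e f : s i e = e -> pi_op i (e * f) = e * pi_op i f.
Proof.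
move=> he; apply: pi_op_unique; rewrite mulrCA pi_opP msymM he.
move: (VX (lo i)) (VX (hi i)) (s i f) => x y g; ring.
Qed.

Lemma pi_op_inv i f : s i f = f -> pi_op i f = f.
Proof. by move=> h; apply: pi_op_unique; rewrite h mulrBl. Qed.

Lemma sgen_pi_op i f : s i (pi_op i f) = pi_op i f.
Proof.
apply: esym; apply: pi_op_unique; have := congr1 (msym (sgen i)) (pi_opP i f).
rewrite !msymM !msymB !msymM !sgen_X sgen_lo sgen_hi sgen_sq => /(congr1 -%R).
by rewrite opprB -mulNr opprB.
Qed.

Lemma pi_op_idem i f : pi_op i (pi_op i f) = pi_op i f.
Proof. exact/pi_op_inv/sgen_pi_op. Qed.

Lemma pi_op_comm i j f : (i.+1 < j)%N -> pi_op i (pi_op j f) = pi_op j (pi_op i f).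
Proof.
move=> hij; apply: pi_op_unique.
have e1 : sgen i (lo j) = lo j by apply: sgen_id => /=; lia.
have e2 : sgen i (hi j) = hi j by apply: sgen_id => /=; lia.
have e3 : sgen j (lo i) = lo i by apply: sgen_id => /=; lia.
have e4 : sgen j (hi i) = hi i by apply: sgen_id => /=; lia.
have sij g : s i (s j g) = s j (s i g) by rewrite -!msymMm (sgen_commute hij).
apply: (mulfI (lo_hi_neq0 j)).
have A := pi_opP j (pi_op i f).
have B : (VX (lo j) - VX (hi j)) * s i (pi_op j f) = VX (lo j) * s i f - VX (hi j) * s i (s j f).
  by have := congr1 (msym (sgen i)) (pi_opP j f); rewrite !(msymM, msymB) !sgen_X e1 e2.
have C : (VX (lo i) - VX (hi i)) * s j (pi_op i f) = VX (lo i) * s j f - VX (hi i) * s i (s j f).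
  by have := congr1 (msym (sgen j)) (pi_opP i f); rewrite !(msymM, msymB) !sgen_X e3 e4 sij.
have D := pi_opP i f; have E := pi_opP j f.
rewrite mulrCA A !mulrBr ![(VX (lo i) - VX (hi i)) * (_ * _)]mulrCA D C.
rewrite ![(VX (lo j) - VX (hi j)) * (_ * _)]mulrCA E B.
move: (VX (lo i)) (VX (hi i)) (VX (lo j)) (VX (hi j)) => x y z t.
move: (s i (s j f)) (s i f) (s j f) => a b c; ring.
Qed.

Lemma pi_op_braid i j f : j = i.+1 :> nat ->
  pi_op i (pi_op j (pi_op i f)) = pi_op j (pi_op i (pi_op j f)).
Proof.
move=> hij.
have e0 : lo j = hi i by apply: val_inj.
have e1 : sgen i (hi j) = hi j by apply: sgen_id => /=; lia.
have e2 : sgen j (lo i) = lo i by apply: sgen_id => /=; lia.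
have e3 : sgen j (hi i) = hi j by rewrite -e0 sgen_lo.
have e4 : sgen j (hi j) = hi i by rewrite sgen_hi e0.
have sbr g : s i (s j (s i g)) = s j (s i (s j g)) by rewrite -!msymMm !mulgA (sgen_braid hij).
have P1 g := pi_opP i g; have P2 g := pi_opP j g.
have sP1 g := sgen_pi_op i g; have sP2 g := sgen_pi_op j g.
move: P1 P2 (lo_hi_neq0 i) (lo_hi_neq0 j); rewrite e0.
set x := VX (lo i); set y := VX (hi i); set z := VX (hi j) => P1 P2 nxy nyz.
have sx : s i x = y by rewrite /x sgen_X sgen_lo.
have sy : s i y = x by rewrite /y sgen_X sgen_hi.
have sz : s i z = z by rewrite /z sgen_X e1.
have tx : s j x = x by rewrite /x sgen_X e2.
have ty : s j y = z by rewrite /y sgen_X e3.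
have tz : s j z = y by rewrite /z sgen_X e4.
have nxz : x - z != 0.
  by apply: contraNneq nxy => h; rewrite -tx -tz -msymB h msym0.
clearbody x y z.
(* Both sides equal the antisymmetrization of [x^2 y f] divided by the
   Vandermonde product of [x], [y], [z]. *)
have H1 g : (x - z) * s j (pi_op i g) = x * s j g - z * s j (s i g).
  by have := congr1 (msym (sgen j)) (P1 g); rewrite !(msymM, msymB) tx ty.
have H2 g : (x - z) * s i (pi_op j g) = x * s i g - z * s i (s j g).
  by have := congr1 (msym (sgen i)) (P2 g); rewrite !(msymM, msymB) sy sz.
have H3 g : (y - z) * s i (s j (pi_op i g)) = y * s i (s j g) - z * s i (s j (s i g)).
  by have := congr1 (msym (sgen i)) (H1 g); rewrite !(msymM, msymB) sx sz.
have H4 g : (x - y) * s j (s i (pi_op j g)) = x * s j (s i g) - y * s j (s i (s j g)).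
  by have := congr1 (msym (sgen j)) (H2 g); rewrite !(msymM, msymB) tx tz.
pose V := (x - y) * (y - z) * (x - z).
have nV : V != 0 by rewrite !mulf_neq0.
have L : V * pi_op i (pi_op j (pi_op i f)) =
  x * y * (x * f - y * s i f) - x * z * (x * s j f - z * s j (s i f))
  + y * z * (y * s i (s j f) - z * s i (s j (s i f))).
  transitivity ((x - z) * x * ((y - z) * pi_op j (pi_op i f)) -
      (y - z) * y * ((x - z) * s i (pi_op j (pi_op i f)))).
    have -> : V * pi_op i (pi_op j (pi_op i f)) =
      (y - z) * (x - z) * ((x - y) * pi_op i (pi_op j (pi_op i f))) by rewrite /V; ring.
    by rewrite P1; ring.
  rewrite P2 H2 sP1 -(P1 f) -(H1 f) -(H3 f).
  move: (pi_op i f) (s j (pi_op i f)) (s i (s j (pi_op i f))) => a b c; ring.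
have R : V * pi_op j (pi_op i (pi_op j f)) =
  x * y * (x * f - y * s i f) - x * z * (x * s j f - z * s j (s i f))
  + y * z * (y * s i (s j f) - z * s i (s j (s i f))).
  transitivity ((x - z) * y * ((x - y) * pi_op i (pi_op j f)) -
      (x - y) * z * ((x - z) * s j (pi_op i (pi_op j f)))).
    have -> : V * pi_op j (pi_op i (pi_op j f)) =
      (x - y) * (x - z) * ((y - z) * pi_op j (pi_op i (pi_op j f))) by rewrite /V; ring.
    by rewrite P2; ring.
  rewrite P1 H1 sP2 sbr.
  transitivity (x * x * ((y - z) * pi_op j f) - y * y * ((x - z) * s i (pi_op j f))
    + z * z * ((x - y) * s j (s i (pi_op j f)))); first by ring.
  rewrite P2 H2 H4; move: (s j (s i (s j f))) (s j (s i f)) (s i (s j f)) (s i f) (s j f) => *; ring.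
exact: (mulfI nV (etrans L (esym R))).
Qed.

Lemma braided_pi_op : braided (@pi_op F n).
Proof. split; [exact: pi_opB|move=> *; exact: pi_op_braid|move=> *; exact: pi_op_comm]. Qed.

Definition dem i f := pi_op i f - f.

Lemma braided_dem : braided dem.
Proof. exact: (braided_pred braided_pi_op pi_op_idem).1. Qed.

Lemma dem_quad i f : dem i (dem i f) = - dem i f.
Proof. exact: (braided_pred braided_pi_op pi_op_idem).2. Qed.

Lemma demZ i a f : dem i (a *: f) = a *: dem i f.
Proof. by rewrite /dem pi_opZ scalerBr. Qed.

Lemma dem_mull i e f : s i e = e -> dem i (e * f) = e * dem i f.
Proof. by move=> he; rewrite /dem pi_op_mull // mulrBr. Qed.

End Demazure.

(** * Leading terms and straightening *)

Section LeadingTerms.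
Variables (F : fieldType) (n : nat).
Implicit Types (i j : 'I_n.-1) (f g : {mpoly F[n]}) (m d : 'X_{1..n}) (u v w : 'S_n).

Definition supported (C : 'X_{1..n} -> Prop) f := forall m, f@_m != 0 -> C m.

Lemma supported0 C : supported C 0.
Proof. by move=> m; rewrite mcoeff0 eqxx. Qed.

Lemma supportedD C f g : supported C f -> supported C g -> supported C (f + g).
Proof.
move=> hf hg m; rewrite mcoeffD; have [->|/hf//] := eqVneq f@_m 0.
by rewrite add0r; apply: hg.
Qed.

Lemma supportedZ C a f : supported C f -> supported C (a *: f).
Proof. by move=> hf m; rewrite mcoeffZ mulf_eq0 negb_or => /andP[_ /hf]. Qed.

Lemma supportedN C f : supported C f -> supported C (- f).
Proof. by rewrite -scaleN1r; apply: supportedZ. Qed.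

Lemma supportedB C f g : supported C f -> supported C g -> supported C (f - g).
Proof. by move=> hf hg; apply: supportedD => //; apply: supportedN. Qed.

Lemma supportedX (C : 'X_{1..n} -> Prop) m : C m -> supported C 'X_[m].
Proof. by move=> Cm m'; rewrite mcoeffX; case: (m =P m') => [<-//|_]; rewrite eqxx. Qed.

Lemma supported_sum C (I : eqType) (r : seq I) (P : pred I) (G : I -> {mpoly F[n]}) :
  (forall k, k \in r -> P k -> supported C (G k)) -> supported C (\sum_(k <- r | P k) G k).
Proof.
move=> H; rewrite big_seq_cond; apply: big_ind => [|f g|k /andP[]]; [exact: supported0|exact: supportedD|exact: H].
Qed.

Lemma supported_sub (C C' : 'X_{1..n} -> Prop) f :
  (forall m, C m -> C' m) -> supported C f -> supported C' f.
Proof. by move=> CC' h m /h/CC'. Qed.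

Lemma supported_ind (C : 'X_{1..n} -> Prop) (P : {mpoly F[n]} -> Prop) : P 0 ->
  (forall a f g, P f -> P g -> P (a *: f + g)) -> (forall m, C m -> P 'X_[m]) ->
  forall f, supported C f -> P f.
Proof.
move=> P0 PD PX f hf; rewrite [f]mpolyE big_seq.
apply: (big_ind P) => [//|g1 g2 h1 h2|m].
  by rewrite -[g1]scale1r; apply: PD.
rewrite mcoeff_msupp => /hf/PX h; rewrite -[X in P X]addr0; exact: PD.
Qed.

Lemma setm_sum i m a b (phi : nat -> nat) :
  (\sum_p phi (setm i m a b p) + phi (m (gen_lo i)) + phi (m (gen_hi i)) =
   \sum_p phi (m p) + phi a + phi b)%N.
Proof.
have ne : gen_hi i != gen_lo i by rewrite eq_sym lo_hiF.
rewrite (bigD1 (gen_lo i)) // (bigD1 (gen_hi i)) //=.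
rewrite [in RHS](bigD1 (gen_lo i)) // [in RHS](bigD1 (gen_hi i)) //=.
rewrite !setmE !eqxx (negbTE ne).
under eq_bigr => p /andP[/negbTE h1 /negbTE h2] do rewrite setmE h1 h2.
by lia.
Qed.

Definition sqnorm m := (\sum_p m p ^ 2)%N.
Definition msize_supp m := (\sum_p (0 < m p))%N.

(** The segment from [m] to its s_i-image, end points included: the monomials that may occur in [dem
    i 'X_[m]]. *)
Definition string_le i m m' := exists a b,
  [/\ m' = setm i m a b, (a + b = m (gen_lo i) + m (gen_hi i))%N,
      (minn (m (gen_lo i)) (m (gen_hi i)) <= a)%N & (minn (m (gen_lo i)) (m (gen_hi i)) <= b)%N].

Lemma string_le_mdeg i m m' : string_le i m m' -> mdeg m' = mdeg m.
Proof. by case=> a [b [-> e _ _]]; have := setm_sum i m a b id; rewrite !mdegE; lia. Qed.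

Lemma string_le_sqnorm i m m' : string_le i m m' -> (sqnorm m' <= sqnorm m)%N.
Proof.
case=> a [b [-> e la lb]]; have := setm_sum i m a b (fun x => x ^ 2)%N; rewrite /sqnorm /=.
move: (\sum_p _)%N (\sum_p _)%N => A B; move: e la lb.
by move: (m _) (m _) => x y; rewrite !expnS !expn0; nia.
Qed.

(** Moving two exponents closer together loses no variable; hence the monomials in at least h
    variables span a subspace stable under [dem]. *)
Lemma string_le_supp i m m' : string_le i m m' -> (msize_supp m <= msize_supp m')%N.
Proof.
case=> a [b [-> e la lb]]; have := setm_sum i m a b (fun x => (0 < x)%N); rewrite /msize_supp /=.
move: (\sum_p _)%N (\sum_p _)%N => A B; move: e la lb.
by move: (m _) (m _) => x y; lia.
Qed.

Lemma string_supported i m :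
  supported (fun m' => string_le i m m' /\ (sqnorm m' < sqnorm m)%N) (string F i m).
Proof.
apply: supported_sum => t _ _; apply: supportedX; rewrite /string_le.
set x := m (gen_lo i); set y := m (gen_hi i); have := ltn_ord t; rewrite -/x -/y => lt.
move: (nat_of_ord t) lt => k lt.
set c := minn x y; set l := (maxn x y - c).-1.
have [e kl] : (c + c + l.+1 = x + y /\ k < l)%N.
  by rewrite -/c -/l in lt; split=> //; move: lt; rewrite /l /c; clearbody x y; case: (leqP x y); lia.
split; first by exists (c + (l - k))%N, (c + k.+1)%N; split=> //; clear -e kl; lia.
have := setm_sum i m (c + (l - k)) (c + k.+1) (fun x => x ^ 2)%N; rewrite /sqnorm /= -/x -/y.
move: (\sum_p _)%N (\sum_p _)%N => A B.
have [a a0 la] : exists2 a, (0 < a)%N & l = (a + k)%N by exists (l - k)%N; clear -kl; lia.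
have -> : (l - k = a)%N by clear -la; lia.
have : (x = c /\ y = c + l.+1 \/ y = c /\ x = c + l.+1)%N.
  by move: e; rewrite /c; clearbody x y; case: (leqP x y); lia.
clearbody x y c l; rewrite la => -[]; case=> -> ->; rewrite !expnS !expn0; nia.
Qed.

Lemma dem_mon i m : dem i 'X_[m] =
  if (m (gen_hi i) < m (gen_lo i))%N then string F i m + msym (sgen i) 'X_[m]
  else if m (gen_hi i) == m (gen_lo i) then 0 else - string F i m - 'X_[m].
Proof.
rewrite /dem pi_op_mon /piX; case: ifP => _; first by move: (string F i m) (msym _ _) => *; ring.
by case: ifP => _ //; rewrite subrr.
Qed.

Lemma sgen_mon i m : msym (sgen i) 'X_[m] = 'X_[setm i m (m (gen_hi i)) (m (gen_lo i))] :> {mpoly F[n]}.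
Proof. by rewrite -{1}(setm_id i m) sgen_setm. Qed.

Lemma dem_mon_supported i m : supported (string_le i m) (dem i 'X_[m]).
Proof.
have S := supported_sub (fun _ h => proj1 h) (string_supported (i := i) (m := m)).
rewrite dem_mon; case: ifP => _.
  apply: supportedD => //; rewrite sgen_mon; apply: supportedX.
  by exists (m (gen_hi i)), (m (gen_lo i)); split=> //; lia.
case: ifP => _; first exact: supported0.
apply: supportedB; first exact: supportedN.
apply: supportedX; exists (m (gen_lo i)), (m (gen_hi i)); split; rewrite ?setm_id //; lia.
Qed.

Lemma dem_supported (C : 'X_{1..n} -> Prop) i f :
  (forall m m', C m -> string_le i m m' -> C m') -> supported C f -> supported C (dem i f).
Proof.
move=> CC; move: f; apply: supported_ind => [|a g1 g2 h1 h2|m Cm].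
- by rewrite (braided0 (braided_dem F n)); apply: supported0.
- rewrite (braidedD (braided_dem F n)) demZ; apply: supportedD => //; exact: supportedZ.
- by apply: supported_sub (dem_mon_supported (i := i) (m := m)) => m'; apply: CC.
Qed.

(* With 0-based ranks, [mon u c] is the product over [i] of the [c i]-th powers
   of the monomials in the [i + 1] variables of smallest [u]-rank. *)
Definition mon u (c : 'I_n.-1 -> nat) : 'X_{1..n} := [multinom \sum_(i : 'I_n.-1 | (u p <= i)%N) c i | p < n].

Lemma monE u c p : mon u c p = (\sum_(i : 'I_n.-1 | (u p <= i)%N) c i)%N.
Proof. exact: mnmE. Qed.

Definition ind (J : {set 'I_n.-1}) i : nat := i \in J.

Lemma mon_split u c p q : (u p <= u q)%N ->
  mon u c p = (\sum_(i : 'I_n.-1 | (u p <= i < u q)%N) c i + mon u c q)%N.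
Proof.
move=> pq; rewrite !monE (bigID (fun i : 'I_n.-1 => (i < u q)%N)) /=; congr (_ + _)%N.
by apply: eq_bigl => i; rewrite -leqNgt; lia.
Qed.

Lemma mon_sgen u c i : mon (sgen i * u)%g c = setm i (mon u c) (mon u c (gen_hi i)) (mon u c (gen_lo i)).
Proof.
apply/mnmP=> p; rewrite setmE !monE permM.
case: eqP => [->|n1]; first by rewrite sgen_lo.
case: eqP => [->|n2]; first by rewrite sgen_hi.
rewrite sgen_id //; apply/eqP => e; [apply: n1|apply: n2]; exact: val_inj.
Qed.

Lemma rdesc_sgen i u : ~~ desc i u -> rdesc u \subset rdesc (sgen i * u)%g.
Proof.
move=> nd; apply/subsetP=> j; rewrite !inE invMg sgenV !permM => dj.
apply: sgen_lt => //; apply/negP=> /andP[/eqP e1 /eqP e2].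
move: nd; rewrite /desc.
have -> : gen_lo i = (u^-1)%g (gen_hi j) by apply: val_inj; rewrite /= e1.
have -> : gen_hi i = (u^-1)%g (gen_lo j) by apply: val_inj; rewrite /= e2.
by rewrite !permKV /= ltnS leqnn.
Qed.

(** The inverse of s_i u drops between the two ranks exchanged, so a right descent of s_i u, which
    lies in J, separates the two exponents. Strictness selects the case of [dem_mon] that yields the
    exchanged monomial. *)
Lemma mon_lt_desc i u (J : {set 'I_n.-1}) : ~~ desc i u -> rdesc (sgen i * u)%g \subset J ->
  (mon u (ind J) (gen_hi i) < mon u (ind J) (gen_lo i))%N.
Proof.
move=> nd sJ; have lt : (u (gen_lo i) < u (gen_hi i))%N.
  by move: nd (@perm_lo_hi _ i u); rewrite /desc; lia.
rewrite (mon_split _ (ltnW lt)) -[X in (X < _)%N]add0n ltn_add2r.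
have [|k /andP[k1 k2] dk] :=
    between_drop (f := fun x => ((sgen i * u)^-1)%g x) lt.
  by rewrite invMg sgenV !permM !permK sgen_lo sgen_hi.
rewrite (bigD1 k) ?k1 //= /ind (subsetP sJ) //.
by rewrite inE.
Qed.

Definition lowmon m m' := mdeg m' = mdeg m /\ (sqnorm m' < sqnorm m)%N.

Lemma sqnorm_mon u v c : sqnorm (mon u c) = sqnorm (mon v c).
Proof.
suff H w : sqnorm (mon w c) = sqnorm (mon 1%g c) by rewrite !H.
rewrite /sqnorm (reindex_inj (@perm_inj _ (w^-1)%g)) /=.
by apply: eq_bigr => p _; rewrite !monE permKV perm1.
Qed.

Lemma mdeg_mon u v c : mdeg (mon u c) = mdeg (mon v c).
Proof.
suff H w : mdeg (mon w c) = mdeg (mon 1%g c) by rewrite !H.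
rewrite !mdegE (reindex_inj (@perm_inj _ (w^-1)%g)) /=.
by apply: eq_bigr => p _; rewrite !monE permKV perm1.
Qed.

Definition descX (J : {set 'I_n.-1}) : {mpoly F[n]} := 'X_[mon 1%g (ind J)].
Definition descB u : {mpoly F[n]} := Tw (@dem F n) u (descX (rdesc u)).

Lemma dem_descX (J : {set 'I_n.-1}) i : i \notin J -> dem i (descX J) = 0.
Proof.
move=> iJ; have e : mon 1%g (ind J) (gen_hi i) = mon 1%g (ind J) (gen_lo i).
  rewrite [RHS](@mon_split _ _ _ (gen_hi i)) !perm1 //= big1 // => k hk.
  by rewrite /ind (_ : k = i) ?(negbTE iJ) //; apply: val_inj => /=; lia.
by rewrite dem_mon e ltnn eqxx.
Qed.

(** J is kept apart from D(u): peeling a letter off [u] may shrink its descent set, while the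
    starting monomial must stay the same. *)
Lemma Tw_descX u (J : {set 'I_n.-1}) : rdesc u \subset J ->
  supported (lowmon (mon u (ind J))) (Tw (@dem F n) u (descX J) - 'X_[mon u (ind J)]).
Proof.
have [k] := ubnP (plength u); elim: k u => // k IH u; rewrite ltnS => lu uJ.
have [->|u1] := eqVneq u 1%g; first by rewrite Tw1 subrr; apply: supported0.
have [i di _] := red_cons u1; pose v := (sgen i * u)%g.
have uv : u = (sgen i * v)%g by rewrite mulgA sgenK mul1g.
have nv : ~~ desc i v by rewrite desc_sgenM di.
have vJ : rdesc v \subset J by apply: subset_trans (rdesc_sgen nv) _; rewrite -uv.
have lt : (mon v (ind J) (gen_hi i) < mon v (ind J) (gen_lo i))%N.
  by apply: mon_lt_desc; rewrite -?uv.
have {}IH := IH v (leq_trans (plength_desc di) lu) vJ.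
have low : forall m, lowmon (mon v (ind J)) m -> lowmon (mon u (ind J)) m.
  by move=> m [h1 h2]; rewrite /lowmon (mdeg_mon u v) (sqnorm_mon u v).
apply: (supported_sub low).
rewrite (TwE (braided_dem F n) _ di) -/v.
rewrite -[Tw _ v _](subrK 'X_[mon v (ind J)]) (braidedD (braided_dem F n)) -addrA.
apply: supportedD.
  apply: dem_supported IH => m m' [h1 h2] h; split; first by rewrite (string_le_mdeg h).
  exact: leq_ltn_trans (string_le_sqnorm h) h2.
rewrite dem_mon lt sgen_mon -mon_sgen -uv addrK.
by apply: (supported_sub _ (string_supported (i := i) (m := mon v (ind J)))) => m [/string_le_mdeg].
Qed.

Lemma descB_lead u :
  supported (lowmon (mon u (ind (rdesc u)))) (descB u - 'X_[mon u (ind (rdesc u))]).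
Proof. exact: Tw_descX. Qed.

End LeadingTerms.

(** * Monomials encoded by a sorting permutation and its gaps *)

Section SortedMonomials.
Variable n : nat.
Implicit Types (i j : 'I_n.-1) (m d : 'X_{1..n}) (u v w : 'S_n) (c : 'I_n.-1 -> nat).

(* [sortp m] ranks the positions by decreasing exponent, ties being broken from
   left to right. *)
Definition before m (p q : 'I_n) : bool := (m q < m p)%N || ((m p == m q) && (p < q)%N).

Lemma before_irr m p : before m p p = false.
Proof. by rewrite /before !ltnn andbF. Qed.

Lemma before_trans m p q r : before m p q -> before m q r -> before m p r.
Proof. rewrite /before; lia. Qed.

Lemma before_total m p q : p != q -> before m p q || before m q p.
Proof. by rewrite /before -val_eqE /=; lia. Qed.

Definition rank m (p : 'I_n) : nat := #|[set q | before m q p]|.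

Lemma rank_lt m p q : (rank m p < rank m q)%N = before m p q.
Proof.
have H p' q' : before m p' q' -> (rank m p' < rank m q')%N.
  move=> pq; apply: proper_card; apply/properP; split.
    by apply/subsetP=> r; rewrite !inE => /before_trans; apply.
  by exists p'; rewrite inE ?before_irr.
apply/idP/idP; last exact: H.
have [->|ne] := eqVneq p q; first by rewrite ltnn.
by case/orP: (before_total m ne) => // /H; lia.
Qed.

Lemma rank_ltn m p : (rank m p < n)%N.
Proof.
rewrite -[X in (_ < X)%N]card_ord -cardsT; apply: proper_card; apply/properP.
by split; [apply: subsetT | exists p; rewrite inE ?before_irr].
Qed.

Lemma rank_inj m : injective (fun p => Ordinal (rank_ltn m p)).
Proof.
move=> p q /(congr1 val) /= e; apply/eqP; apply: contraT => ne.
by case/orP: (before_total m ne); rewrite -rank_lt e ltnn.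
Qed.

Definition sortp m : 'S_n := perm (@rank_inj m).

Lemma sortp_lt m p q : (sortp m p < sortp m q)%N = before m p q.
Proof. by rewrite !permE /= rank_lt. Qed.

Definition gap m i := (m ((sortp m)^-1%g (gen_lo i)) - m ((sortp m)^-1%g (gen_hi i)))%N.

(** Exactly the pairs for which [u] is the sorting permutation of [mon u c]; for positive [n] they
    correspond bijectively to the monomials with some zero exponent. *)
Definition adapted u c := forall i, i \in rdesc u -> (0 < c i)%N.

(** If the exponents at two ranks agree, adaptedness excludes a right descent between them, so the
    positions increase, as the tie-break demands. *)
Lemma adapted_lt u c p q : adapted u c -> (u p < u q)%N = before (mon u c) p q.
Proof.
move=> ad; have H p' q' : (u p' < u q')%N -> before (mon u c) p' q'.
  move=> lt; rewrite /before (mon_split c (ltnW lt)).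
  set S := (\sum_(i : _ | _) _)%N; case: (posnP S) => [s0|S0]; last by apply/orP; left; move: S0; lia.
  rewrite s0 add0n ltnn eqxx /= ltnNge; apply/negP=> qp.
  have {}qp : (q' < p')%N.
    by rewrite ltn_neqAle qp andbT; apply: contraTneq lt => /val_inj->; rewrite ltnn.
  have [|i ilt di] := between_drop (f := fun x => (u^-1)%g x) lt; first by rewrite !permK.
  have : i \in rdesc u by rewrite inE.
  by move/ad; move/eqP: s0; rewrite sum_nat_eq0 => /forallP/(_ i); rewrite ilt /=; lia.
apply/idP/idP; first exact: H.
apply: contraTT; rewrite -leqNgt leq_eqVlt => /orP[/eqP/val_inj/perm_inj->|/H].
  by rewrite before_irr.
by apply: contraL => /before_trans h; apply/negP=> /h; rewrite before_irr.
Qed.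

Lemma sortp_mon u c : adapted u c -> sortp (mon u c) = u.
Proof. by move=> ad; apply: perm_lt_inj => p q; rewrite sortp_lt -adapted_lt. Qed.

Lemma mon_gap u c i : (mon u c ((u^-1)%g (gen_lo i)) - mon u c ((u^-1)%g (gen_hi i)))%N = c i.
Proof.
rewrite (@mon_split _ _ _ ((u^-1)%g (gen_lo i)) ((u^-1)%g (gen_hi i))) !permKV //= addnK.
rewrite (bigD1 i) ?leqnn ?ltnSn //= big1 ?addn0 // => k /andP[h] /eqP[]; apply: val_inj => /=; lia.
Qed.

Lemma gap_mon u c i : adapted u c -> gap (mon u c) i = c i.
Proof. by move=> ad; rewrite /gap sortp_mon // mon_gap. Qed.

Lemma msize_supp_le m p : (0 < p)%N -> (p <= n)%N -> (msize_supp m < p)%N ->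
  exists q, m q = 0%N.
Proof.
move=> p0 pn lt; case: (pickP (fun q => m q == 0%N)) => [q /eqP|no]; first by exists q.
suff : msize_supp m = n by lia.
rewrite /msize_supp (eq_bigr (fun=> 1%N)) ?sum_nat_const ?card_ord ?muln1 // => q _.
by rewrite lt0n no.
Qed.

Lemma adapted_gap m : adapted (sortp m) (gap m).
Proof.
move=> i; rewrite inE /gap; set u := sortp m => di.
have : (u ((u^-1)%g (gen_lo i)) < u ((u^-1)%g (gen_hi i)))%N by rewrite !permKV /=.
by rewrite sortp_lt /before -/u subn_gt0 => /orP[//|/andP[_]]; move: di; lia.
Qed.

(** [mon] uses products of at most n - 1 variables and cannot encode a factor common to all of them;
    the zero exponent excludes such a factor. *)
Lemma mon_sortp m : (exists q, m q = 0%N) -> mon (sortp m) (gap m) = m.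
Proof.
case=> q0 mq0; apply/mnmP=> p; set u := sortp m.
have H k : forall x : 'I_n, (n - x <= k)%N -> m ((u^-1)%g x) = (\sum_(i : 'I_n.-1 | (x <= i)%N) gap m i)%N.
  elim: k => [|k IH] x hx; first by have := ltn_ord x; lia.
  have anti (a b : 'I_n) : (a <= b)%N -> (m ((u^-1)%g b) <= m ((u^-1)%g a))%N.
    rewrite leq_eqVlt => /orP[/eqP/val_inj->//|].
    by rewrite -{1}(permKV u a) -{1}(permKV u b) sortp_lt /before; lia.
  have [xl|xl] := ltnP x n.-1; last first.
    rewrite big1 => [|i xi]; last by have := ltn_ord i; lia.
    have := anti (u q0) x; rewrite permK mq0 leqn0 => h; apply/eqP/h.
    by have := ltn_ord (u q0); lia.
  pose i := Ordinal xl; have -> : x = gen_lo i by apply: val_inj.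
  rewrite (bigD1 i) //= (eq_bigl (fun k : 'I_n.-1 => (gen_hi i <= k)%N)); last first.
    by move=> l; rewrite -val_eqE /=; lia.
  rewrite -(IH (gen_hi i)) /=; last by move: hx (ltn_ord x) => /=; lia.
  by rewrite /gap -/u subnK // anti.
by rewrite monE -(H n) ?permK //; lia.
Qed.

Lemma msize_suppE m : msize_supp m = #|[set p | (0 < m p)%N]|.
Proof. by rewrite -sum1dep_card /msize_supp -big_mkcond /=; apply: eq_bigr => p; case: (0 < _)%N. Qed.

Lemma card_rank_le u k : (k < n)%N -> #|[set p | (u p <= k)%N]| = k.+1.
Proof.
move=> kn; have -> : [set p | (u p <= k)%N] = (u^-1)%g @: [set x : 'I_n | (x < k.+1)%N].
  apply/setP=> p; rewrite inE; apply/idP/imsetP => [h|[x]]; last by rewrite inE ltnS => h ->; rewrite permKV.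
  by exists (u p); rewrite ?inE ?ltnS ?permK.
rewrite card_imset; last exact: perm_inj.
by rewrite -sum1dep_card (big_ord_narrow kn) sum1_card card_ord.
Qed.

Lemma mon_supp_lt u c h i : (msize_supp (mon u c) < h)%N -> (0 < c i)%N -> (i.+1 < h)%N.
Proof.
move=> lt ci; apply: leq_ltn_trans lt; have kn := gen_hi_proof i.
rewrite -(card_rank_le u (ltnW kn)) msize_suppE; apply: subset_leq_card.
by apply/subsetP=> p; rewrite !inE monE => pi; rewrite (bigD1 i) //= addn_gt0 ci.
Qed.

Lemma mon_supp u c h : (0 < h)%N -> (h <= n)%N -> (forall i, (0 < c i)%N -> (i.+1 < h)%N) ->
  (msize_supp (mon u c) < h)%N.
Proof.
move=> h0 hn H; rewrite msize_suppE.
have S : [set p | (0 < mon u c p)%N] \subset [set p | (u p < h.-1)%N].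
  apply/subsetP=> p; rewrite !inE monE lt0n sum_nat_eq0 negb_forall => /existsP[i].
  by rewrite negb_imply -lt0n => /andP[pi /H]; lia.
apply: leq_ltn_trans (subset_leq_card S) _.
case: h h0 hn {H S} => // -[|k] _ hn /=; first by rewrite (_ : [set _ | _] = set0) ?cards0 //; apply/setP=> p; rewrite !inE.
by rewrite card_rank_le // ltnW.
Qed.

End SortedMonomials.

(** * Garsia's straightening *)

Section Straightening.
Variables (F : fieldType) (n h : nat).
Hypotheses (h_gt0 : (0 < h)%N) (h_le : (h <= n)%N).
Implicit Types (i j : 'I_n.-1) (f g : {mpoly F[n]}) (p q : 'I_n) (m d : 'X_{1..n}) (u v w : 'S_n)
  (c : 'I_n.-1 -> nat) (A : {set 'I_n}).

Local Notation e_ r := (mesym n F r).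

(* Basis of the polynomial ring indexed by monomials: a monomial in fewer than
   [h] variables is uniquely [mon u c] with [c] positive on [rdesc u], and the
   excess of [c] over [rdesc u] gives the exponents of the [e_i]. *)
Definition straightB m : {mpoly F[n]} :=
  if (msize_supp m < h)%N then
    descB F (sortp m) * \prod_(i : 'I_n.-1) e_ i.+1 ^+ (gap m i - ind (rdesc (sortp m)) i)
  else 'X_[m].

Lemma straightB_mon u c : adapted u c -> (msize_supp (mon u c) < h)%N ->
  straightB (mon u c) = descB F u * \prod_(i : 'I_n.-1) e_ i.+1 ^+ (c i - ind (rdesc u) i).
Proof.
move=> ad lt; rewrite /straightB lt sortp_mon //; congr (_ * _).
by apply: eq_bigr => i _; rewrite gap_mon.
Qed.

Lemma straightB_supp m : (h <= msize_supp m)%N -> straightB m = 'X_[m].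
Proof. by rewrite /straightB ltnNge => ->. Qed.

(* The linear span of the [straightB m], [C m], as an intersection of subspaces. *)
Definition fspan (C : 'X_{1..n} -> Prop) f := forall P : {mpoly F[n]} -> Prop,
  P 0 -> (forall a x y, P x -> P y -> P (a *: x + y)) -> (forall m, C m -> P (straightB m)) -> P f.

Lemma fspan0 C : fspan C 0.
Proof. by move=> P. Qed.

Lemma fspan_lin C a f g : fspan C f -> fspan C g -> fspan C (a *: f + g).
Proof. by move=> hf hg P P0 PD Pf; apply: (PD); [apply: hf | apply: hg]. Qed.

Lemma fspan_gen (C : 'X_{1..n} -> Prop) m : C m -> fspan C (straightB m).
Proof. by move=> Cm P _ _; apply. Qed.

Lemma fspanZ C a f : fspan C f -> fspan C (a *: f).
Proof. by move=> hf; rewrite -[_ *: _]addr0; apply: fspan_lin => //; apply: fspan0. Qed.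

Lemma fspanD C f g : fspan C f -> fspan C g -> fspan C (f + g).
Proof. by move=> hf hg; rewrite -[f]scale1r; apply: fspan_lin. Qed.

Lemma fspanB C f g : fspan C f -> fspan C g -> fspan C (f - g).
Proof. by move=> hf hg; rewrite addrC -scaleN1r; apply: fspan_lin. Qed.

Lemma fspan_sum C (I : Type) (r : seq I) (P : pred I) (G : I -> {mpoly F[n]}) :
  (forall k, P k -> fspan C (G k)) -> fspan C (\sum_(k <- r | P k) G k).
Proof. by move=> H; apply: (big_ind (fspan C)) => [|x y|k /H//]; [apply: fspan0 | apply: fspanD]. Qed.

Lemma fspan_sub (C C' : 'X_{1..n} -> Prop) f :
  (forall m, C m -> C' m) -> fspan C f -> fspan C' f.
Proof. by move=> CC hf; apply: hf => [|a x y|m /CC]; [apply: fspan0|apply: fspan_lin|apply: fspan_gen]. Qed.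

Lemma fspan_supported (C C' : 'X_{1..n} -> Prop) f :
  (forall m, C m -> fspan C' 'X_[m]) -> supported C f -> fspan C' f.
Proof.
move=> H; move: f; apply: supported_ind => [|a x y|m /H//]; first exact: fspan0.
exact: fspan_lin.
Qed.

Lemma mpolyX_mesym m r :
  'X_[m] * e_ r = \sum_(A : {set 'I_n} | #|A| == r) 'X_[(m + mesym1 A)%MM].
Proof.
rewrite mesymE big_distrr /=; apply: eq_bigr => A _; by rewrite mpolyXD.
Qed.

Lemma msize_supp_add m m' : (msize_supp m <= msize_supp (m + m')%MM)%N.
Proof. by apply: leq_sum => p _; rewrite mnmDE; case: (m p) => //. Qed.

Definition incr_at c i : 'I_n.-1 -> nat := fun k => (c k + (k == i))%N.

Lemma mon_incr u c i : mon u (incr_at c i) = (mon u c + mesym1 [set p | (u p <= i)%N])%MM.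
Proof.
apply/mnmP=> p; rewrite mnmDE !monE big_split /=; congr (_ + _)%N.
rewrite mnmE inE; have [le|lt] := leqP (u p) i.
  by rewrite (bigD1 i) //= eqxx big1 // => k /andP[_ /negbTE->].
by rewrite big1 // => k pk; case: eqP => // e; move: lt; rewrite -e ltnNge pk.
Qed.

Lemma adapted_incr u c i : adapted u c -> adapted u (incr_at c i).
Proof. by move=> ad k /ad; rewrite /incr_at addn_gt0 => ->. Qed.

Lemma msize_supp_incr u c i : (i.+1 < h)%N -> (msize_supp (mon u c) < h)%N ->
  (msize_supp (mon u (incr_at c i)) < h)%N.
Proof.
move=> ih lt; apply: mon_supp => // k; rewrite /incr_at addn_gt0.
case/orP => [|]; first exact: mon_supp_lt lt.
by case: eqP => // ->.
Qed.

Lemma mdeg_incr u c i : mdeg (mon u (incr_at c i)) = (mdeg (mon u c) + i.+1)%N.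
Proof.
by rewrite mon_incr mdegD mdeg_mesym1 card_rank_le // ltnW // gen_hi_proof.
Qed.

Lemma mesym_straightB u c i : (i.+1 < h)%N -> adapted u c -> (msize_supp (mon u c) < h)%N ->
  e_ i.+1 * straightB (mon u c) = straightB (mon u (incr_at c i)).
Proof.
move=> ih ad lt; rewrite !straightB_mon ?msize_supp_incr //; last exact: adapted_incr.
rewrite mulrCA; congr (_ * _).
rewrite [RHS](eq_bigr (fun k : 'I_n.-1 => e_ k.+1 ^+ (c k - ind (rdesc u) k) * e_ k.+1 ^+ (k == i))).
  rewrite big_split /= mulrC; congr (_ * _).
  by rewrite (bigD1 i) //= eqxx expr1 big1 ?mulr1 // => k /negbTE->.
move=> k _; rewrite -exprD /incr_at; congr (_ ^+ _).
(* Adaptedness keeps the truncated difference in the exponent exact, so it grows with the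
   increment. *)
have : (ind (rdesc u) k <= c k)%N by rewrite /ind; case: (boolP (k \in _)) => // /ad.
by move: (ind _ _) => x; lia.
Qed.

Lemma adapted_supp m : (msize_supp m < h)%N -> m = mon (sortp m) (gap m).
Proof. by move=> lt; rewrite mon_sortp //; apply: (msize_supp_le h_gt0 h_le lt). Qed.

Lemma mesym_fspan D i f : (i.+1 < h)%N -> fspan (fun m => mdeg m = D) f ->
  fspan (fun m => mdeg m = (D + i.+1)%N) (e_ i.+1 * f).
Proof.
move=> ih hp; apply: (hp (fun f => fspan _ (e_ i.+1 * f))) => [|a x y hx hy|m hm].
- by rewrite mulr0; apply: fspan0.
- by rewrite mulrDr -scalerAr; apply: fspan_lin.
have [ge|lt] := leqP h (msize_supp m).
  rewrite straightB_supp // mulrC mpolyX_mesym; apply: fspan_sum => A /eqP cA.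
  rewrite -straightB_supp; last exact: leq_trans ge (msize_supp_add _ _).
  by apply: fspan_gen; rewrite mdegD mdeg_mesym1 hm cA.
rewrite (adapted_supp lt) mesym_straightB -?(adapted_supp lt) //; last exact: adapted_gap.
by apply: fspan_gen; rewrite mdeg_incr -(adapted_supp lt) hm.
Qed.

(* The linear part breaks ties between monomials with the same exponents up to
   order, preferring large exponents on the left; [N] makes it negligible
   against the sum of squares. *)
Definition key N m := (N * sqnorm m + 2 * \sum_(p < n) (n - p) * m p)%N.

(** The linear part of [key] is at most 2 n mdeg m, less than the N lost with one unit of the sum of
    squares. *)
Lemma key_lowmon N m m' : (2 * n * mdeg m < N)%N -> lowmon m m' -> (key N m' < key N m)%N.
Proof.
move=> hN [e lt]; rewrite /key.
have : (\sum_(p < n) (n - p) * m' p <= n * mdeg m)%N.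
  by rewrite -e mdegE big_distrr /=; apply: leq_sum => p _; rewrite leq_mul2r leq_subr orbT.
have : (N * sqnorm m' + N <= N * sqnorm m)%N by rewrite addnC -mulnS leq_mul2l lt orbT.
move: (\sum_(p < n) _ * m' p)%N (\sum_(p < n) _ * m p)%N hN => x y; rewrite -mulnA.
move: (n * _)%N (N * _)%N (N * _)%N => *; lia.
Qed.

(** Raising the exponent at p adds 2 m p + 1 to the sum of squares; the factor 2 in [key] turns the
    total increment into 2 v(p) + N with v(p) = N m p + (n - p). For sets A of equal size only the
    sum of these weights matters. *)
Lemma key_add N m A :
  key N (m + mesym1 A)%MM = (key N m + (\sum_(p in A) (2 * (N * m p + (n - p)) + N)))%N.
Proof.
have H (G G' : 'I_n -> nat) (K : 'I_n -> nat) : (forall p, G p = G' p + (p \in A) * K p)%N ->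
    (\sum_p G p = \sum_p G' p + \sum_(p in A) K p)%N.
  move=> e; rewrite [\sum_(p in A) _]big_mkcond -big_split /=; apply: eq_bigr => p _.
  by rewrite e; case: (p \in A); rewrite ?mul1n.
rewrite /key /sqnorm (H (fun p => (m + mesym1 A)%MM p ^ 2)%N (fun p => m p ^ 2)%N (fun p => 2 * m p + 1)%N); last first.
  by move=> p; rewrite mnmDE mnmE; case: (p \in A); rewrite !expnS !expn0; lia.
rewrite (H (fun p : 'I_n => (n - p) * (m + mesym1 A)%MM p)%N (fun p : 'I_n => (n - p) * m p)%N (fun p : 'I_n => n - p)%N); last first.
  by move=> p; rewrite mnmDE mnmE; case: (p \in A); lia.
rewrite !mulnDr addnACA; congr (_ + _)%N; rewrite !big_distrr -big_split /=.
by apply: eq_bigr => p _; lia.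
Qed.

(** Once common elements are removed, the weights left in A are below the weight at rank i, while
    those on the other side are at least that weight. *)
Lemma rank_set_max u i A (v : 'I_n -> nat) :
  (forall p q, (u p < u q)%N -> (v q < v p)%N) -> #|A| = i.+1 -> A != [set p | (u p <= i)%N] ->
  (\sum_(p in A) v p < \sum_(p in [set p | (u p <= i)%N]) v p)%N.
Proof.
set S := finset _ => H cA neA.
have cS : #|S| = i.+1 by rewrite card_rank_le // ltnW // gen_hi_proof.
rewrite (big_setID S) [X in (_ < X)%N](big_setID A) /= [S :&: A]setIC ltn_add2l.
have cD : #|A :\: S| = #|S :\: A| by have := cardsID S A; have := cardsID A S; rewrite setIC; lia.
have D0 : (0 < #|A :\: S|)%N.
  rewrite card_gt0 setD_eq0; apply: contraNN neA => sAS.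
  by rewrite eqEcard sAS cA cS leqnn.
pose b := v ((u^-1)%g (gen_lo i)).
apply: (@leq_trans (b * #|A :\: S|)%N).
  rewrite mulnC -sum_nat_const; move/card_gt0P: D0 => [q qD].
  have lt p : p \in A :\: S -> (v p < b)%N.
    by rewrite !inE -ltnNge => /andP[lt _]; apply: H; rewrite permKV.
  rewrite (bigD1 q) // [X in (_ < X)%N](bigD1 q) //= -addSn leq_add ?lt //.
  by apply: leq_sum => p /andP[/lt/ltnW].
rewrite cD mulnC -sum_nat_const; apply: leq_sum => p; rewrite !inE => /andP[_].
rewrite leq_eqVlt => /orP[/eqP e|lt]; last by apply/ltnW/H; rewrite permKV.
by rewrite /b (_ : _ (gen_lo i) = p) //; apply: (canLR (permK u)); apply: val_inj.
Qed.

(** The outer induction on the degree serves the cofactor of an e_i, the inner one on [key] the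
    other monomials of the same degree. *)
Lemma fspan_mon m : fspan (fun m' => mdeg m' = mdeg m) 'X_[m].
Proof.
move e: (mdeg m) => D; have [B] := ubnP D; elim: B D m e => // B IHB D m e.
(* N exceeds 2 n D, for [key_lowmon], and n, so that in the weights one unit of exponent outweighs
   any difference of positions. *)
rewrite ltnS => DB; have [N NE] : exists N, N = (2 * n * D + n).+1 by eexists.
have [K] := ubnP (key N m); elim: K m e => // K IHK m e; rewrite ltnS => kK.
have [ge|lt] := leqP h (msize_supp m).
  by rewrite -straightB_supp //; apply: fspan_gen.
move: (adapted_supp lt) (@adapted_gap _ m); move: (sortp m) (gap m) => u c em ad.
(* Either the product of the i + 1 variables of smallest rank can be traded for e_{i+1}, or [c] is
   the indicator of D(u) and the monomial is the leading term of [descB F u]. *)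
case: (pickP (fun i => (ind (rdesc u) i < c i)%N)) => [i ci|no]; last first.
  have ec : c =1 ind (rdesc u).
    move=> i; have := no i; have : (ind (rdesc u) i <= c i)%N.
      by rewrite /ind; case: (boolP (i \in _)) => // /ad.
    by move: (ind _ _) (c i) => *; lia.
  have em' : m = mon u (ind (rdesc u)).
    by rewrite em; apply/mnmP=> p; rewrite !monE; apply: eq_bigr => i _; rewrite ec.
  have -> : 'X_[m] = straightB m - (descB F u - 'X_[m]).
    rewrite [in straightB m]em straightB_mon -?em // big1 ?mulr1 ?subKr //.
    by move=> i _; rewrite ec subnn expr0.
  apply: fspanB; first exact: fspan_gen.
  have := @descB_lead F n u; rewrite -em'; apply: fspan_supported => m' low.
  apply: IHK; first by rewrite low.1.
  by apply: leq_trans kK; apply: key_lowmon low; rewrite NE e; lia.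
pose c' k := (c k - (k == i))%N.
have cc' : c =1 incr_at c' i.
  move=> k; rewrite /incr_at /c'; case: eqP => [->|_]; last by rewrite subn0 addn0.
  by rewrite subnK // (leq_ltn_trans _ ci).
have ad' : adapted u c'.
  move=> k kr; rewrite /c'; have := ad k kr; case: eqP => [ek|_]; last by rewrite subn0.
  by move: ci; rewrite /ind -ek kr; lia.
pose g := mon u c'; pose S := [set p | (u p <= i)%N].
have eg : m = (g + mesym1 S)%MM.
  rewrite em /g -mon_incr; apply/mnmP=> p; rewrite !monE; apply: eq_bigr => k _.
  by rewrite cc'.
have ih : (i.+1 < h)%N by apply: (@mon_supp_lt _ u c); rewrite -?em //; move: ci; lia.
have cS : #|S| = i.+1 by rewrite card_rank_le // ltnW // gen_hi_proof.
have eD : (mdeg g + i.+1 = D)%N by rewrite -e eg mdegD mdeg_mesym1 cS.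
(* The monomial of [m] is the term A = S of ['X_[g]] times e_{i+1}; solving for it leaves that
   product and terms of smaller [key]. *)
have := mpolyX_mesym g i.+1; rewrite (bigD1 S) ?cS //= -eg => /esym/(canRL (addrK _)) ->.
apply: fspanB.
  rewrite mulrC -eD; apply: mesym_fspan => //; apply: IHB => //; move: DB; rewrite -eD; lia.
apply: fspan_sum => A /andP[/eqP cA neA].
apply: IHK; first by rewrite mdegD mdeg_mesym1 cA.
apply: leq_trans kK; rewrite eg !key_add ltn_add2l.
have sE (B' : {set 'I_n}) : (\sum_(p in B') (2 * (N * g p + (n - p)) + N) =
    2 * (\sum_(p in B') (N * g p + (n - p))) + #|B'| * N)%N.
  by rewrite big_split /= sum_nat_const big_distrr.
rewrite !sE cA cS ltn_add2r ltn_pmul2l //.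
apply: (rank_set_max (u := u)) => // p q; rewrite (adapted_lt p q ad') -/g /before => bpq.
have pn := ltn_ord p; have qn := ltn_ord q.
case/orP: bpq => [lpq|/andP[/eqP-> pq]]; last by rewrite ltn_add2l; lia.
have : (N * g q + N <= N * g p)%N by rewrite addnC -mulnS leq_mul2l lpq orbT.
by rewrite NE; move: (_ * _)%N (_ * _)%N; lia.
Qed.

End Straightening.

(** * The quotient by the Tanisaki ideal of a hook *)

Section StraightBasis.
Variables (F : fieldType) (n h : nat).
Hypotheses (h_gt0 : (0 < h)%N) (h_le : (h <= n)%N).
Implicit Types (i j : 'I_n.-1) (f g : {mpoly F[n]}) (p : 'I_n) (m d : 'X_{1..n}) (u v w : 'S_n).

Local Notation e_ r := (mesym n F r).
Local Notation sB := (straightB F h).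

Lemma left_inverse_free (T : finType) (A B : T -> T -> F) :
  (forall x z, \sum_y A x y * B y z = (x == z)%:R) ->
  forall a : T -> F, (forall z, \sum_y a y * B y z = 0) -> forall x, a x = 0.
Proof.
move=> AB a aB x.
pose MA : 'M[F]_#|T| := \matrix_(i, j) A (enum_val i) (enum_val j).
pose MB : 'M[F]_#|T| := \matrix_(i, j) B (enum_val i) (enum_val j).
pose va : 'rV[F]_#|T| := \row_i a (enum_val i).
have sumT (G : T -> F) : \sum_(i < #|T|) G (enum_val i) = \sum_y G y.
  by rewrite [RHS](reindex _ (onW_bij _ (@enum_val_bij T))).
have E : MB *m MA = 1%:M.
  apply: mulmx1C; apply/matrixP=> i j; rewrite !mxE.
  under eq_bigr => k _ do rewrite !mxE.
  by rewrite (sumT (fun y => A (enum_val i) y * B y (enum_val j))) AB (inj_eq enum_val_inj).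
have va0 : va *m MB = 0.
  apply/rowP=> j; rewrite !mxE; under eq_bigr => k _ do rewrite !mxE.
  by rewrite (sumT (fun y => a y * B y (enum_val j))) aB.
have : va = 0 by rewrite -[va]mulmx1 -E mulmxA va0 mul0mx.
by move=> /rowP/(_ (enum_rank x)); rewrite !mxE enum_rankK.
Qed.

(* A spanning family indexed by a basis is free: [A B = 1] gives [B A = 1]. *)
Lemma straightB_free D (a : 'X_{1..n < D} -> F) :
  \sum_(m : 'X_{1..n < D}) a m *: sB m = 0 -> forall m : 'X_{1..n < D}, a m = 0.
Proof.
move=> a0; have : forall m : 'X_{1..n < D},
    exists c : 'X_{1..n < D} -> F, 'X_[m] = \sum_(m' : 'X_{1..n < D}) c m' *: sB m'.
  move=> m; apply: (@fspan_mon F _ _ h_gt0 h_le m (fun f => exists c : 'X_{1..n < D} -> F,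
    f = \sum_(m' : 'X_{1..n < D}) c m' *: sB m')) => [|b x y [cx ->] [cy ->]|m' em].
  - by exists (fun=> 0); rewrite big1 // => k _; rewrite scale0r.
  - exists (fun k => b * cx k + cy k); rewrite scaler_sumr -big_split /=.
    by apply: eq_bigr => k _; rewrite scalerDl scalerA.
  have lt : (mdeg m' < D)%N by rewrite em bmdeg.
  exists (fun k => (k == BMultinom lt)%:R); rewrite (bigD1 (BMultinom lt)) //= eqxx scale1r.
  by rewrite big1 ?addr0 // => k /negbTE->; rewrite scale0r.
case/fin_all_exists => A HA; apply: (left_inverse_free (A := A) (B := fun k z => (sB k)@_z)) => [x z|z].
  have := congr1 (mcoeff z) (HA x); rewrite mcoeffX raddf_sum /= bmeqP => ->.
  by apply: eq_bigr => y _; rewrite mcoeffZ.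
transitivity (\sum_(m : 'X_{1..n < D}) a m *: sB m)@_z; last by rewrite a0 mcoeff0.
rewrite raddf_sum /=.
by apply: eq_bigr => y _; rewrite mcoeffZ.
Qed.

(** Makes the span explicit over finitely many monomials; asking for all large D lets two
    combinations share a truncation. *)
Definition bounded_comb (C : 'X_{1..n} -> Prop) f := exists D0, forall D, (D0 <= D)%N ->
  exists2 c : 'X_{1..n} -> F, (forall m, c m != 0 -> C m) &
    f = \sum_(m : 'X_{1..n < D}) c m *: sB m.

Lemma fspan_bounded (C : 'X_{1..n} -> Prop) f : fspan h C f -> bounded_comb C f.
Proof.
move=> hf; apply: (hf (bounded_comb C)) => [|a x y [D1 H1] [D2 H2]|m Cm].
- exists 0 => D _; exists (fun=> 0) => [m|]; first by rewrite eqxx.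
  by rewrite big1 // => k _; rewrite scale0r.
- exists (maxn D1 D2) => D; rewrite geq_max => /andP[/H1[cx hx ->] /H2[cy hy ->]].
  exists (fun k => a * cx k + cy k) => [m|].
    have [->|/hx//] := eqVneq (cx m) 0; by rewrite mulr0 add0r => /hy.
  rewrite scaler_sumr -big_split /=.
  by apply: eq_bigr => k _; rewrite scalerDl scalerA.
exists (mdeg m).+1 => D lt; exists (fun k => (k == m)%:R) => [k|].
  by case: (k =P m) => [->//|_]; rewrite eqxx.
rewrite (bigD1 (BMultinom lt)) //= eqxx scale1r big1 ?addr0 // => k.
by rewrite bmeqP /= => /negbTE->; rewrite scale0r.
Qed.

Lemma straightB_indep a m : fspan h (fun m' => m' <> m) (a *: sB m) -> a = 0.
Proof.
move=> /fspan_bounded[D0 /(_ (maxn D0 (mdeg m).+1))]; rewrite leq_maxl => /(_ isT)[c hc e].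
have lt : (mdeg m < maxn D0 (mdeg m).+1)%N by rewrite leq_max leqnn orbT.
have cm : c m = 0 by apply/eqP; apply: contraT => /hc.
have := @straightB_free _ (fun k => c k - a * (k == m :> 'X_{1..n})%:R) _ (BMultinom lt).
rewrite /= cm eqxx mulr1 sub0r => H; apply/eqP; rewrite -oppr_eq0; apply/eqP/H.
under eq_bigr => k _ do rewrite scalerBl; rewrite sumrB -e (bigD1 (BMultinom lt)) //= eqxx mulr1.
rewrite big1 ?addr0 ?subrr // => k; rewrite bmeqP /= => /negbTE->.
by rewrite mulr0 scale0r.
Qed.

(** Normal form for the elements of the hook ideal. [q] carries no cofactors because the span of the
    monomials in at least h variables is already an ideal. *)
Definition hookI f := exists g : 'I_n.-1 -> {mpoly F[n]}, exists q : {mpoly F[n]},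
  supported (fun m => (h <= msize_supp m)%N) q /\
  f = \sum_(i : 'I_n.-1 | (i.+1 < h)%N) g i * e_ i.+1 + q.

Lemma hookI_lin a f g : hookI f -> hookI g -> hookI (a *: f + g).
Proof.
move=> [gf [qf [sf ->]]] [gg [qg [sg ->]]].
exists (fun i => a *: gf i + gg i), (a *: qf + qg); split.
  by apply: supportedD => //; apply: supportedZ.
under [X in _ = X + _]eq_bigr => i _ do rewrite mulrDl -scalerAl.
by rewrite big_split /= -scaler_sumr scalerDr addrACA.
Qed.

Lemma hookI0 : hookI 0.
Proof.
exists (fun=> 0), 0; split; first exact: supported0.
by rewrite big1 ?addr0 // => i _; rewrite mul0r.
Qed.

Lemma hookI_supp q : supported (fun m => (h <= msize_supp m)%N) q -> hookI q.
Proof.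
move=> sq; exists (fun=> 0), q; split=> //.
by rewrite big1 ?add0r // => i _; rewrite mul0r.
Qed.

Lemma hookI_mesym i f : (i.+1 < h)%N -> hookI (f * e_ i.+1).
Proof.
move=> ih; exists (fun k => if k == i then f else 0), 0; split; first exact: supported0.
rewrite addr0 (bigD1 i) //= eqxx big1 ?addr0 // => k /andP[_ /negbTE->].
by rewrite mul0r.
Qed.

Lemma hookI_dem i f : hookI f -> hookI (dem i f).
Proof.
move=> [g [q [sq ->]]]; exists (fun k => dem i (g k)), (dem i q); split.
  by apply: dem_supported sq => m m' lem /string_le_supp; apply: leq_trans.
have bd := braided_dem F n.
rewrite (braidedD bd); congr (_ + _).
rewrite (big_morph (dem i) (braidedD bd i) (braided0 bd i)).
apply: eq_bigr => k _; rewrite mulrC dem_mull 1?mulrC //.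
by have /issymP := mesym_sym n F k.+1.
Qed.

Lemma descB_straightB u : (forall i, i \in rdesc u -> (i.+1 < h)%N) ->
  descB F u = sB (mon u (ind (rdesc u))).
Proof.
move=> H; rewrite straightB_mon //.
- by rewrite big1 ?mulr1 // => i _; rewrite subnn expr0.
- by move=> i; rewrite /ind => ->.
- by apply: mon_supp => // i; rewrite /ind; case: (boolP (i \in _)) => // /H.
Qed.

Definition hookS u := [forall i, (i \in rdesc u) ==> (i.+1 < h)%N].

Lemma hookSP u : reflect (forall i, i \in rdesc u -> (i.+1 < h)%N) (hookS u).
Proof. by apply: (iffP forallP) => H i; [move/implyP: (H i) | apply/implyP/H]. Qed.

(** Any basis element other than a [descB F u] with [hookS h u] is a monomial in at least h
    variables or has a factor e_{i+1} with i + 1 < h. *)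
Lemma fspan_hookI (C : 'X_{1..n} -> Prop) f :
  (forall u, hookS u -> C (mon u (ind (rdesc u))) -> False) ->
  fspan h C f -> hookI f.
Proof.
move=> nC hf; apply: (hf hookI) => [|a x y|m Cm]; [exact: hookI0 | exact: hookI_lin|].
have [ge|lt] := leqP h (msize_supp m).
  by rewrite straightB_supp //; apply: hookI_supp; apply: supportedX.
move: (adapted_supp h_gt0 h_le lt) (@adapted_gap _ m); move: (sortp m) (gap m) => u c em ad.
case: (pickP (fun i => (ind (rdesc u) i < c i)%N)) => [i ci|no].
  rewrite em straightB_mon -?em // (bigD1 i) //=.
  rewrite (_ : (c i - ind (rdesc u) i = (c i - ind (rdesc u) i).-1.+1)%N); last by rewrite prednK // subn_gt0.
  rewrite exprS mulrCA -mulrA mulrC; apply: hookI_mesym.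
  by apply: (@mon_supp_lt _ u c); rewrite -?em //; move: ci; lia.
have ec : c =1 ind (rdesc u).
  move=> i; have := no i; have : (ind (rdesc u) i <= c i)%N.
    by rewrite /ind; case: (boolP (i \in _)) => // /ad.
  by move: (ind _ _) (c i) => *; lia.
have em' : m = mon u (ind (rdesc u)).
  by rewrite em; apply/mnmP=> p; rewrite !monE; apply: eq_bigr => i _; rewrite ec.
case: (nC u); rewrite -?em' //; apply/hookSP => i iu.
by apply: (@mon_supp_lt _ u (ind (rdesc u))); rewrite -?em' // /ind iu.
Qed.

(** Multiplying a basis element by e_{i+1} raises its gap at i above the indicator of D(u), so a
    descent element never results. *)
Lemma hookI_fspan f : hookI f ->
  fspan h (fun m => forall u, hookS u -> m <> mon u (ind (rdesc u))) f.
Proof.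
have big m : (h <= msize_supp m)%N -> forall u, hookS u -> m <> mon u (ind (rdesc u)).
  move=> ge u /hookSP Hu e; move: ge; rewrite e leqNgt mon_supp // => i.
  by rewrite /ind; case: (boolP (i \in _)) => // /Hu.
move=> [g [q [sq ->]]]; apply: fspanD; last first.
  apply: fspan_supported sq => m ge; rewrite -(straightB_supp F ge); apply: fspan_gen; exact: big.
apply: fspan_sum => i ih.
have : fspan h (fun=> True) (g i).
  apply: (fspan_supported (C := fun=> True)) => // m _.
  by apply: (@fspan_sub F n h (fun m' => mdeg m' = mdeg m)) => //; apply: fspan_mon.
move: (g i) => {g} g hg; set C := (X in fspan h X _).
apply: (hg (fun g => fspan h C (g * e_ i.+1))) => [|a x y hx hy|m _].
- by rewrite mul0r; apply: fspan0.
- by rewrite mulrDl -scalerAl; apply: fspan_lin.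
have [ge|lt] := leqP h (msize_supp m).
  rewrite straightB_supp // mpolyX_mesym; apply: fspan_sum => A /eqP cA.
  have ge' := leq_trans ge (msize_supp_add m (mesym1 A)).
  by rewrite -(straightB_supp F ge'); apply: fspan_gen; apply: big.
move: (adapted_supp h_gt0 h_le lt) (@adapted_gap _ m); move: (sortp m) (gap m) => u c em ad.
rewrite mulrC em mesym_straightB -?em //; apply: fspan_gen => v /hookSP Hv e.
have adv : adapted v (ind (rdesc v)) by move=> k; rewrite /ind => ->.
have uv : u = v by rewrite -(sortp_mon (adapted_incr i ad)) e sortp_mon.
have := gap_mon i (adapted_incr i ad); rewrite e gap_mon // /incr_at eqxx addn1 -uv.
rewrite /ind; case: (boolP (i \in _)) => // /ad; lia.
Qed.

Lemma descB_span f : exists a : 'S_n -> F, hookI (f - \sum_(u | hookS u) a u *: descB F u).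
Proof.
have : fspan h (fun=> True) f.
  apply: (fspan_supported (C := fun=> True)) => // m _.
  by apply: (@fspan_sub F n h (fun m' => mdeg m' = mdeg m)) => //; apply: fspan_mon.
move=> hf; apply: (hf (fun f => exists a : 'S_n -> F,
    hookI (f - \sum_(u | hookS u) a u *: descB F u))) => [|b x y [ax hx] [ay hy]|m _].
- exists (fun=> 0); rewrite big1 ?subrr => [|u _]; last by rewrite scale0r.
  exact: hookI0.
- exists (fun u => b * ax u + ay u).
  under eq_bigr => u _ do rewrite scalerDl -scalerA.
  rewrite big_split /= -scaler_sumr opprD addrACA -scalerBr; exact: hookI_lin.
case: (pickP (fun u => hookS u && (m == mon u (ind (rdesc u))))) => [u /andP[Hu /eqP em]|no].
  exists (fun v => (v == u)%:R); rewrite (bigD1 u) //= eqxx scale1r.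
  rewrite em -descB_straightB; last exact/hookSP.
  rewrite big1 ?addr0 ?subrr => [|v /andP[_ /negbTE->]]; last by rewrite scale0r.
  exact: hookI0.
exists (fun=> 0); rewrite big1 ?subr0 => [|u _]; last by rewrite scale0r.
apply: (@fspan_hookI (fun m' => m' = m)); last exact: fspan_gen.
by move=> u Hu e; have := no u; rewrite Hu e eqxx.
Qed.

Lemma descB_indep (a : 'S_n -> F) : hookI (\sum_(u | hookS u) a u *: descB F u) ->
  forall u, hookS u -> a u = 0.
Proof.
move=> HI u Hu; have adv v : adapted v (ind (rdesc v)) by move=> k; rewrite /ind => ->.
apply: (@straightB_indep _ (mon u (ind (rdesc u)))).
rewrite -descB_straightB; last exact/hookSP.
move: HI; rewrite (bigD1 u) //=; set r := \sum_(v | _) _ => /hookI_fspan HI.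
rewrite -[_ *: _](addrK r); apply: fspanB.
  by apply: (fspan_sub _ HI) => m; apply.
apply: fspan_sum => v /andP[Hv ne]; apply: fspanZ; rewrite descB_straightB; last exact/hookSP.
apply: fspan_gen => e; case/eqP: ne.
by rewrite -(sortp_mon (adv v)) e sortp_mon.
Qed.

End StraightBasis.

(** * Tanisaki generators of a hook *)

Section TanisakiHook.
Variables (F : fieldType) (n h : nat).
Hypotheses (h_gt0 : (0 < h)%N) (h_le : (h <= n)%N).
Implicit Types (i j : 'I_n.-1) (f g : {mpoly F[n]}) (m : 'X_{1..n}) (A S : {set 'I_n}).

(** The conjugate hook in increasing order is 0^{h-1}, 1^{n-h}, h: truncated subtraction covers the
    zeros, and the last part brings the sum to n. *)
Lemma dk_hook k : (k <= n)%N -> dk n (hook_parts n h) k = if k == n then n else (k.+1 - h)%N.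
Proof.
elim: k => [|k IH] kn; first by rewrite /dk big_geq //; case: eqP => // e; lia.
rewrite /dk big_nat_recr // -/(dk n (hook_parts n h) k) IH ?(ltnW kn) // (ltn_eqF kn).
rewrite /conjpart /= count_nseq subSS; case: (k.+1 =P n) => e; move: kn h_gt0 h_le; lia.
Qed.

Lemma tanisaki_hook S r : tanisaki_gen (hook_parts n h) S r =
  (r <= #|S|)%N && (if #|S| == n then 0 < r else h <= r)%N.
Proof.
have Sn : (#|S| <= n)%N by rewrite -[X in (_ <= X)%N]card_ord max_card.
rewrite /tanisaki_gen dk_hook //; case: (leqP r #|S|) => //= rS.
by case: eqP => e; lia.
Qed.

Lemma prod_mesym1 A : \prod_(k in A) 'X_k = 'X_[mesym1 A] :> {mpoly F[n]}.
Proof.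
have -> : mesym1 A = (\sum_(k in A) U_(k))%MM.
  apply/mnmP=> p; rewrite mnm_sumE mnmE; case: (boolP (p \in A)) => pA.
    rewrite (bigD1 p) //= mnm1E eqxx big1 // => k /andP[_ /negbTE].
    by rewrite mnm1E => ->.
  by rewrite big1 // => k kA; rewrite mnm1E; case: eqP => // e; rewrite -e kA in pA.
by rewrite (big_morph (fun m => 'X_[m] : {mpoly F[n]}) (@mpolyXD n F) (mpolyX0 n F)).
Qed.

Lemma msize_supp_mesym1 A : msize_supp (mesym1 A) = #|A|.
Proof.
rewrite msize_suppE; apply: eq_card => p; rewrite inE mnmE.
by case: (p \in A).
Qed.

Lemma supported_mull g f : supported (fun m => (h <= msize_supp m)%N) f ->
  supported (fun m => (h <= msize_supp m)%N) (g * f).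
Proof.
move: f; apply: supported_ind => [|a x y hx hy|m ge].
- by rewrite mulr0; apply: supported0.
- by rewrite mulrDr -scalerAr; apply: supportedD => //; apply: supportedZ.
have : supported (fun=> True) g by [].
move: g; apply: supported_ind => [|a x y hx hy|m' _].
- by rewrite mul0r; apply: supported0.
- by rewrite mulrDl -scalerAl; apply: supportedD => //; apply: supportedZ.
rewrite -mpolyXD addmC; apply: supportedX; exact: leq_trans ge (msize_supp_add _ _).
Qed.

Lemma esubT r : esub F [set: 'I_n] r = mesym n F r.
Proof. by apply: eq_bigl => A; rewrite subsetT. Qed.

(** A generator with r >= h is a sum of squarefree monomials in r variables; r < h forces S to
    contain all variables. *)
Lemma inI_hookI f : inI (hook_parts n h) f -> hookI h f.
Proof.
case=> s [/allP gs ->]; rewrite big_seq; apply: (big_ind (@hookI F n h)) => [|x y hx hy|t ts].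
- exact: hookI0.
- by rewrite -[x]scale1r; apply: hookI_lin.
move/gs: ts; rewrite tanisaki_hook; case: t => g [S r] /= /andP[rS H].
have [ge|lt] := leqP h r.
  apply: hookI_supp; apply: supported_mull; apply: supported_sum => A _ /andP[_ /eqP cA].
  by rewrite prod_mesym1; apply: supportedX; rewrite msize_supp_mesym1 cA.
have [cS r0] : #|S| = n /\ (0 < r)%N by move: H; case: eqP => // _; lia.
have -> : S = setT by apply/eqP; rewrite eqEcard subsetT cardsT card_ord cS leqnn.
have rn : (r.-1 < n.-1)%N by lia.
rewrite esubT; have := @hookI_mesym F n h (Ordinal rn) g; rewrite /= prednK //; exact.
Qed.

Lemma inI_lin a f g : inI (hook_parts n h) f -> inI (hook_parts n h) g ->
  inI (hook_parts n h) (a *: f + g).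
Proof.
move=> [s [hs ->]] [r [hr ->]]; exists ([seq (a *: t.1, t.2) | t <- s] ++ r).
rewrite all_cat all_map hr andbT; split=> //.
rewrite big_cat big_map /= scaler_sumr; congr (_ + _).
by apply: eq_bigr => t _; rewrite scalerAl.
Qed.

Lemma inI_gen g S r : tanisaki_gen (hook_parts n h) S r -> inI (hook_parts n h) (g * esub F S r).
Proof. by move=> H; exists [:: (g, (S, r))]; rewrite big_seq1 /= H. Qed.

Lemma inI0 : inI (hook_parts n h) (0 : {mpoly F[n]}).
Proof. by exists [::]; rewrite big_nil. Qed.

(** On exactly h variables e_h is a single squarefree monomial, which divides ['X_[m]] when the
    variables are taken from its support. *)
Lemma inI_mon m : (h <= msize_supp m)%N -> inI (hook_parts n h) ('X_[m] : {mpoly F[n]}).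
Proof.
rewrite msize_suppE; set S := finset _ => hS.
pose A := [set x in take h (enum S)].
have cA : #|A| = h.
  rewrite cardsE (card_uniqP (take_uniq _ (enum_uniq _))) size_takel //.
  by rewrite -cardE.
have AS p : p \in A -> (0 < m p)%N.
  by rewrite inE => /mem_take; rewrite mem_enum inE.
have -> : 'X_[m] = 'X_[(m - mesym1 A)%MM] * esub F A h.
  rewrite /esub (bigD1 A) ?subxx ?cA //= [X in _ + X]big1 => [|B /andP[/andP[BA /eqP cB] /eqP[]]]; last first.
    by apply/eqP; rewrite eqEcard BA cA cB leqnn.
  rewrite addr0 prod_mesym1 -mpolyXD; congr 'X_[_]; apply/mnmP=> p.
  rewrite mnmDE mnmBE mnmE; case: (boolP (p \in A)) => [/AS mp|_]; last by rewrite subn0 addn0.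
  by rewrite subnK.
apply: inI_gen; rewrite tanisaki_hook cA leqnn /=; by case: ifP.
Qed.

Lemma hookI_inI f : hookI h f -> inI (hook_parts n h) f.
Proof.
move=> [g [q [sq ->]]].
have inID (x y : {mpoly F[n]}) : inI (hook_parts n h) x -> inI (hook_parts n h) y -> inI (hook_parts n h) (x + y).
  by move=> hx hy; rewrite -[x]scale1r; apply: inI_lin.
apply: (inID).
  apply: (big_ind (inI (hook_parts n h))) => [|x y|i ih]; [exact: inI0|exact: inID|].
  rewrite -esubT; apply: inI_gen; rewrite tanisaki_hook cardsT card_ord eqxx andbT.
  exact: ltnW (gen_hi_proof i).
move: q sq; apply: supported_ind => [|a x y|m]; [exact: inI0|exact: inI_lin|exact: inI_mon].
Qed.

Lemma mem_Dset_hook i : (i \in Dset n (hook_comp n h)) = (i.+1 < h)%N.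
Proof.
have hi := gen_hi_proof i; rewrite inE /hook_comp size_rcons size_nseq.
have sum_lt k : (k < h)%N -> sumn (take k (rcons (nseq h.-1 1%N) (n - h + 1)%N)) = k.
  move=> kh; rewrite -cats1 takel_cat ?size_nseq; last by lia.
  by rewrite take_nseq ?sumn_nseq ?mul1n //; lia.
apply/mapP/idP => [[k]|ih]; last first.
  by exists i.+1; rewrite ?sum_lt // mem_iota; lia.
rewrite mem_iota add1n => /andP[k0 kh].
have [lt|ge] := ltnP k h; first by rewrite sum_lt // => ->.
have -> : k = (size (rcons (nseq h.-1 1%N) (n - h + 1)%N)) by rewrite size_rcons size_nseq; lia.
rewrite take_size sumn_rcons sumn_nseq; lia.
Qed.

Lemma hookS_Dset (u : 'S_n) : hookS h u = (rdesc u \subset Dset n (hook_comp n h)).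
Proof.
apply/hookSP/subsetP => H i => [/H|]; first by rewrite mem_Dset_hook.
by rewrite -mem_Dset_hook; apply: H.
Qed.

End TanisakiHook.

(** * The isomorphism *)

Section DirectSum.
Variables (F : fieldType) (n h : nat).
Hypotheses (h_gt0 : (0 < h)%N) (h_le : (h <= n)%N).
Implicit Types (J : {set 'I_n.-1}) (f g : {mpoly F[n]}).

Local Notation bigsum := {ffun {set 'I_n.-1} -> Hreg F n}.
Local Notation D := (Dset n (hook_comp n h)).

Definition in_sum (m : bigsum) : Prop := forall J : {set 'I_n.-1},
  (J \subset D -> inP J (m J)) /\ (~~ (J \subset D) -> m J = 0).

Definition evalJ J (c : Hreg F n) := Hmor (@dem F n) (descX F J) c.
Definition eval_sum (m : bigsum) := \sum_(J : {set 'I_n.-1} | J \subset D) evalJ J (m J).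

Lemma evalJ_lin J a (c d : Hreg F n) : evalJ J [ffun u => a * c u + d u] = a *: evalJ J c + evalJ J d.
Proof. exact: Hmor_lin. Qed.

Lemma evalJ_sum J (P : pred 'S_n) (a : 'S_n -> F) (G : 'S_n -> Hreg F n) :
  evalJ J (\sum_(w | P w) scalef (a w) (G w)) = \sum_(w | P w) a w *: evalJ J (G w).
Proof.
have e0 : evalJ J 0 = 0.
  by rewrite /evalJ /Hmor big1 // => w _; rewrite ffunE scale0r.
elim/big_rec2: _ => [//|w y x _ <-]; rewrite -evalJ_lin; congr (evalJ J _).
by apply/ffunP=> u; rewrite !ffunE.
Qed.

Lemma evalJ_projB J w : evalJ J (projB F J w) = Tw (@dem F n) w (descX F J).
Proof.
rewrite /evalJ /projB -[Tw (@Tact F n) w _]/(applyT (red w) (projE F J)).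
rewrite (Hmor_word _ (braided_dem F n) (@dem_quad F n) (@demZ F n)).
rewrite (Hmor_applyTp (braided_dem F n) (@dem_quad F n) (@demZ F n)) // => i /w0word_sub.
by rewrite inE => iJ; apply: dem_descX.
Qed.

(** The sets D(w) partition the permutations, so one coefficient per [w] describes all summands at
    once. *)
Lemma eval_sum_projB (m : bigsum) (a : 'S_n -> F) :
  (forall J, J \subset D -> m J = \sum_(w | rdesc w == J) scalef (a w) (projB F J w)) ->
  eval_sum m = \sum_(w | hookS h w) a w *: descB F w.
Proof.
move=> H; rewrite [RHS](partition_big (@rdesc n) (fun J => J \subset D)) /=; last first.
  by move=> w; rewrite hookS_Dset.
apply: eq_bigr => J JD; rewrite H // evalJ_sum.
apply: eq_big => [w|w /eqP <-]; last by rewrite evalJ_projB.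
by case: eqP => [e|_]; rewrite ?andbF // andbT hookS_Dset // e JD.
Qed.

Lemma eval_sum_surj f : exists m : bigsum, in_sum m /\ hookI h (f - eval_sum m).
Proof.
have [a Ha] := descB_span h_gt0 h_le f.
pose m : bigsum := [ffun J : {set 'I_n.-1} => if J \subset D then
  \sum_(w | rdesc w == J) scalef (a w) (projB F J w) else 0].
exists m; split; last by rewrite (@eval_sum_projB m a) // => J JD; rewrite ffunE JD.
move=> J; rewrite ffunE; split=> [JD|/negbTE-> //]; rewrite JD.
elim/big_rec: _ => [|w c /eqP eJ hc]; first exact: inP0.
have := inP_lin (a w) (inP_projB F w) ; rewrite eJ => /(_ _ hc).
by congr (inP J _); apply/ffunP=> u; rewrite !ffunE.
Qed.

Lemma eval_sum_inj (m : bigsum) : in_sum m -> hookI h (eval_sum m) -> m = 0.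
Proof.
move=> vm Im.
have : forall J : {set 'I_n.-1}, exists a : 'S_n -> F,
    J \subset D -> m J = \sum_(w | rdesc w == J) scalef (a w) (projB F J w).
  move=> J; case: (boolP (J \subset D)) => [/(vm J).1/inP_projB_span[a ->]|_]; first by exists a.
  by exists (fun=> 0).
(* The coefficients found for each J matter only where D(w) = J, so they glue to one function of
   [w]. *)
case/fin_all_exists => a Ha; pose c w := a (rdesc w) w.
have Hc J : J \subset D -> m J = \sum_(w | rdesc w == J) scalef (c w) (projB F J w).
  by move=> /Ha->; apply: eq_bigr => w /eqP e; rewrite /c e.
rewrite (eval_sum_projB Hc) in Im.
have c0 := descB_indep h_gt0 h_le Im.
apply/ffunP=> J; rewrite [RHS]ffunE.
case: (boolP (J \subset D)) => [JD|/(vm J).2//].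
rewrite Hc // big1 // => w /eqP e; rewrite c0 ?hookS_Dset ?e //.
by apply/ffunP=> u; rewrite !ffunE mul0r.
Qed.

Definition lin_sum a (m m' : bigsum) : bigsum := [ffun J => [ffun u => a * m J u + m' J u]].

Lemma in_sum_lin a (m m' : bigsum) : in_sum m -> in_sum m' -> in_sum (lin_sum a m m').
Proof.
move=> vm vm' J; rewrite ffunE; split=> JD.
  by apply: inP_lin; [apply: (vm J).1 | apply: (vm' J).1].
by apply/ffunP=> u; rewrite ffunE (vm J).2 // (vm' J).2 // !ffunE mulr0 addr0.
Qed.

Lemma eval_sum_lin a (m m' : bigsum) : eval_sum (lin_sum a m m') = a *: eval_sum m + eval_sum m'.
Proof.
rewrite /eval_sum scaler_sumr -big_split /=; apply: eq_bigr => J _.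
by rewrite ffunE evalJ_lin.
Qed.

Lemma in_sum_Tact i (m : bigsum) : in_sum m -> in_sum [ffun J => Tact i (m J)].
Proof.
move=> vm J; rewrite ffunE; split=> JD; first by apply/inP_Tact/(vm J).1.
by rewrite (vm J).2 // (braided0 (braided_Tact F n)).
Qed.

Lemma eval_sum_Tact i (m : bigsum) : eval_sum [ffun J => Tact i (m J)] = dem i (eval_sum m).
Proof.
rewrite /eval_sum (big_morph (dem i) (braidedD (braided_dem F n) i) (braided0 (braided_dem F n) i)).
apply: eq_bigr => J _; rewrite ffunE.
exact: (Hmor_Tact _ (braided_dem F n) (@dem_quad F n) (@demZ F n)).
Qed.

Definition coords f : bigsum :=
  epsilon (inhabits 0) (fun m => in_sum m /\ hookI h (f - eval_sum m)).

Lemma coordsP f : in_sum (coords f) /\ hookI h (f - eval_sum (coords f)).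
Proof. exact: (epsilon_spec (inhabits 0) _ (eval_sum_surj f)). Qed.

(** Reduces linearity, kernel, surjectivity and equivariance of [coords] to exhibiting a member of
    the sum with the right value modulo the ideal. *)
Lemma coords_unique f m : in_sum m -> hookI h (f - eval_sum m) -> coords f = m.
Proof.
move=> vm Im; have [vc Ic] := coordsP f.
have : lin_sum (-1) m (coords f) = 0.
  apply: eval_sum_inj; first exact: in_sum_lin.
  rewrite eval_sum_lin scaleN1r.
  have -> : - eval_sum m + eval_sum (coords f) =
      (-1) *: (f - eval_sum (coords f)) + (f - eval_sum m).
    by rewrite scaleN1r; ring.
  exact: hookI_lin.
move=> /ffunP E; apply/ffunP=> J; have := E J; rewrite !ffunE => /ffunP EJ.
apply/ffunP=> u; have := EJ u; rewrite !ffunE mulN1r => /eqP.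
by rewrite addrC subr_eq0 => /eqP.
Qed.

End DirectSum.

(* R_mu = F[x]/I_mu  ~=  (+)_{alpha <= mu} P_alpha as H_n(0)-modules, expressed as
   a linear surjection phi : F[x] -> (+)_{D(alpha) \subset D(mu)} P_alpha with
   kernel exactly I_mu, intertwining T_i = pi_i - 1 with T_i.
   Summands are indexed by J = D(alpha) (compositions of n <-> subsets of [n-1]). *)
Theorem theorem8p3 (F : fieldType) (n h : nat) (h_ge1 : (1 <= h)%N) (h_len : (h <= n)%N) :
  exists phi : {mpoly F[n]} -> {ffun {set 'I_n.-1} -> Hreg F n},
    [/\ forall (a : F) (p q : {mpoly F[n]}),
          phi (a *: p + q) = [ffun J => [ffun u => a * phi p J u + phi q J u]],
        forall (p : {mpoly F[n]}) (J : {set 'I_n.-1}),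
          (J \subset Dset n (hook_comp n h) -> inP J (phi p J)) /\
          (~~ (J \subset Dset n (hook_comp n h)) -> phi p J = 0),
        forall m : {ffun {set 'I_n.-1} -> Hreg F n},
          (forall J : {set 'I_n.-1}, (J \subset Dset n (hook_comp n h) -> inP J (m J)) /\
                     (~~ (J \subset Dset n (hook_comp n h)) -> m J = 0)) ->
          exists p, phi p = m,
        forall p : {mpoly F[n]}, phi p = 0 <-> inI (hook_parts n h) p
      & forall (i : 'I_n.-1) (p : {mpoly F[n]}),
          phi (pi_op i p - p) = [ffun J => Tact i (phi p J)]].
Proof.
have unique := coords_unique h_ge1 h_len; have spec := @coordsP F n h h_ge1 h_len.
have ev0 : eval_sum h (0 : {ffun {set 'I_n.-1} -> Hreg F n}) = 0.
  rewrite /eval_sum big1 // => J _; rewrite ffunE /evalJ /Hmor big1 // => w _.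
  by rewrite ffunE scale0r.
exists (@coords F n h); split.
- move=> a p q; apply: unique; first exact: in_sum_lin (spec p).1 (spec q).1.
  rewrite eval_sum_lin opprD addrACA -scalerBr.
  exact: hookI_lin (spec p).2 (spec q).2.
- by move=> p; apply: (spec p).1.
- move=> m vm; exists (eval_sum h m); apply: unique => //; rewrite subrr; exact: hookI0.
- move=> p; split=> [e|Ip].
    have := (spec p).2; rewrite e ev0 subr0; exact: hookI_inI.
  apply: unique; last by rewrite ev0 subr0; apply: inI_hookI.
  by move=> J; rewrite ffunE; split=> // _; apply: inP0.
- move=> i p; apply: unique; first exact: in_sum_Tact (spec p).1.
  rewrite eval_sum_Tact -/(dem i p) -(braidedB (braided_dem F n)).
  exact: hookI_dem (spec p).2.
Qed.
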